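(* For every simple root $\alpha$, the Demazure--Lusztig operators with dynamical parameters $$T_\alpha^{z,\lambda}=\delta_\alpha^{\mathrm d}\frac{\theta(\hbar)\theta(z_\alpha+\lambda_{\alpha^\vee})}{\theta(z_\alpha)\theta(\hbar+\lambda_{\alpha^\vee})}+\delta_\alpha^{\mathrm d}\frac{\theta(\hbar-z_\alpha)\theta(-\lambda_{\alpha^\vee})}{\theta(z_\alpha)\theta(\hbar+\lambda_{\alpha^\vee})}\delta_\alpha,$$ $$T_\alpha^{z,\lambda,\mathrm d}=\delta_\alpha\frac{\theta(\hbar)\theta(\lambda_{\alpha^\vee}+z_\alpha)}{\theta(\lambda_{\alpha^\vee})\theta(\hbar-z_\alpha)}+\delta_\alpha\frac{\theta(\hbar+\lambda_{\alpha^\vee})\theta(-z_\alpha)}{\theta(\lambda_{\alpha^\vee})\theta(\hbar-z_\alpha)}\delta_\alpha^{\mathrm d}$$ are rational sections of $\mathbb{S}''=\bigoplus_{w,v\in W}\mathbb{S}''_{w,v}$ and of $\mathbb{S}'=\bigoplus_{w,v\in W}\mathbb{S}'_{w,v}$, respectively.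
   Context: Root datum: $(X^*,X_*,\Phi,\Phi^\vee)$ is a root datum with perfect pairing $\langle\,,\rangle$, Weyl group $W$, chosen simple roots, and $\rho,\rho^\vee$ the half-sums of positive roots and of positive coroots. Geometry: $E=\mathbb{C}/(\mathbb{Z}+\mathbb{Z}\tau)$, $\operatorname{Im}\tau>0$, $q=e^{2\pi i\tau}$; $\theta(x)=\frac{1}{2\pi i}(e^{\pi i x}-e^{-\pi i x})\prod_{s>0}(1-q^se^{2\pi ix})(1-q^se^{-2\pi ix})\prod_{s>0}(1-q^s)^{-2}$. $\mathfrak{A}=X_*\otimes E$, $\mathfrak{A}^\vee=X^*\otimes E\cong\mathrm{Pic}^0(\mathfrak{A})$, coordinates $z\in\mathfrak{A}$, $\lambda\in\mathfrak{A}^\vee$; $z_\mu\in E$ is the image of $z$ under $\mu\in X^*$, $\lambda_{\mu^\vee}\in E$ the image of $\lambda$ under $\mu^\vee\in X_*$. $\mathcal{O}(\lambda)$ is the degree-0 line bundle on $\mathfrak{A}$ given by $\lambda$ (for $\mathfrak A=E$, $\mathcal{O}(t)=\mathcal{O}(\{t\}-\{0\})$). $W$ acts on $\mathfrak{A}$ (element $w$) and on $\mathfrak{A}^\vee$ (element written $w^{\mathrm d}$). Fix $\hbar\in E$. $\mathcal{P}$ is the Poincaré line bundle on $\mathfrak{A}\times\mathfrak{A}^\vee$ with $\mathcal{P}|_{\mathfrak{A}\times\lambda}\cong\mathcal{O}(\lambda)$, normalized to be trivial on $\{\hbar\rho^\vee\}\times\mathfrak{A}^\vee$. $\mathbb{L}$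 is the pullback of $\mathcal{P}$ under $(z,\lambda)\mapsto(z,\lambda+\hbar\rho)$. Twisted algebras: $\mathbb{S}_{w,v}=\mathbb{L}\otimes(w^{-1})^*(v^{-1})^{\mathrm d*}\mathbb{L}^{-1}$, $\mathbb{S}'_{w,v}=w^*\mathbb{S}_{w,v}$, $\mathbb{S}''_{w,v}=v^{\mathrm d*}\mathbb{S}_{w,v}$. The symbols $\delta_w,\delta_v^{\mathrm d}$ record the degree: $a\delta_w\delta_v^{\mathrm d}$ (resp. $\delta_wa\delta_v^{\mathrm d}$, resp. $\delta_v^{\mathrm d}a\delta_w$) denotes the rational section $a$ of $\mathbb{S}_{w,v}$ (resp. $\mathbb{S}'_{w,v}$, resp. $\mathbb{S}''_{w,v}$), a missing symbol meaning degree $e$; $\delta_\alpha=\delta_{s_\alpha}$, $\delta^{\mathrm d}_\alpha=\delta^{\mathrm d}_{s_\alpha}$. Sections as functions: with a lift of $\hbar$ to $\mathbb{C}$, rational sections of $\mathbb{L}$ are identified with meromorphic functions $f(z,\lambda)$ on $(X_*\otimes\mathbb{C})\times(X^*\otimes\mathbb{C})$ invariant under $X_*\times X^*$ with $f(z+\tau\mu^\vee,\lambda)=e^{2\pi i\langle\lambda+\hbar\rho,\mu^\vee\rangle}f(z,\lambda)$ and $f(z,\lambda+\tau\mu)=e^{2\pi i\langle\mu,z-\hbar\rho^\vee\rangle}f(z,\lambda)$; sections of pullbacks, tensor products and inverses of $\mathbb{L}$ correspondingly.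
   Formalization: The root datum is assumed reduced (proportional roots are equal or opposite); for a non-reduced datum, e.g. type BC_1, the pairing of ρ with the simple coroot is 3 instead of 1 and the claim fails for generic ħ. *)

(* Defs.v *)
From HB Require Import structures.
From mathcomp Require Import all_boot all_order all_algebra.
From mathcomp Require Import finmap.
From mathcomp Require Import complex.
From mathcomp Require Import all_classical all_reals all_analysis.

Set Implicit Arguments.
Unset Strict Implicit.
Unset Printing Implicit Defensive.

Import Order.TTheory GRing.Theory Num.Theory numFieldNormedType.Exports.

Local Open Scope classical_set_scope.
Local Open Scope complex_scope.
Local Open Scope ring_scope.

(** The lattices X^* and X_* are given in coordinates: both are the row vectors
    ['rV[int]_n], and the perfect pairing is given by a unimodular matrix.
    Lattice endomorphisms are matrices acting on row vectors on the right. *)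

Section PairingDef.
Context {K : pzRingType} {n : nat}.

Definition pairing_of (P : 'M[int]_n) (x y : 'rV[K]_n) : K :=
  (x *m map_mx intr P *m y^T) 0 0.

End PairingDef.

Definition pre_refl {n : nat} (P : 'M[int]_n) (a a' x : 'rV[int]_n) :
  'rV[int]_n := x - pairing_of P x a' *: a.

Definition pre_corefl {n : nat} (P : 'M[int]_n) (a a' y : 'rV[int]_n) :
  'rV[int]_n := y - pairing_of P a y *: a'.

(** The set of coroots is [coroot @` roots].  The last axiom says that the
    root datum is reduced. *)
Record root_datum (n : nat) := RootDatum {
  pairing_mx : 'M[int]_n;
  pairing_perfect : pairing_mx \in unitmx;
  roots : {fset 'rV[int]_n};
  coroot : 'rV[int]_n -> 'rV[int]_n;
  coroot_inj : {in roots &, injective coroot};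
  pairing_coroot : forall a, a \in roots ->
    pairing_of pairing_mx a (coroot a) = 2%:R;
  refl_stable : forall a b, a \in roots -> b \in roots ->
    pre_refl pairing_mx a (coroot a) b \in roots;
  corefl_stable : forall a b, a \in roots -> b \in roots ->
    exists2 c, c \in roots &
      pre_corefl pairing_mx a (coroot a) (coroot b) = coroot c;
  roots_reduced : forall a b (p q : int), a \in roots -> b \in roots ->
    q != 0 -> p *: a = q *: b -> b = a \/ b = - a
}.

Notation pairing D := (pairing_of (pairing_mx D)).

Record root_base (n : nat) (D : root_datum n) := RootBase {
  ss_rank : nat;
  simple : 'I_ss_rank -> 'rV[int]_n;
  simple_root : forall i, simple i \in roots D;
  simple_free : forall c : 'I_ss_rank -> int,
    \sum_i c i *: simple i = 0 -> forall i, c i = 0;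
  simple_span : forall b, b \in roots D ->
    exists c : 'I_ss_rank -> nat,
      b = \sum_i simple i *+ c i \/ b = - \sum_i simple i *+ c i
}.

Arguments simple {n D} _ _.

Definition positive {n : nat} {D : root_datum n} (B : root_base D)
    (b : 'rV[int]_n) : Prop :=
  b \in roots D /\
  exists c : 'I_(ss_rank B) -> nat, b = \sum_i simple B i *+ c i.

(** An element of W is recorded together with its actions on both lattices:
    the pair [w] acts on X^* by [w.1] and on X_* by [w.2].  The Weyl group is
    generated by the pairs (s_a, s_a^vee), a in Phi. *)

Section Weyl.
Context {n : nat} (D : root_datum n).

Definition refl_mx (a : 'rV[int]_n) : 'M[int]_n :=
  lin1_mx (pre_refl (pairing_mx D) a (coroot D a)).

Definition corefl_mx (a : 'rV[int]_n) : 'M[int]_n :=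
  lin1_mx (pre_corefl (pairing_mx D) a (coroot D a)).

Inductive in_weyl : 'M[int]_n * 'M[int]_n -> Prop :=
| in_weyl_id : in_weyl (1%:M, 1%:M)
| in_weyl_refl w a : in_weyl w -> a \in roots D ->
    in_weyl (w.1 *m refl_mx a, w.2 *m corefl_mx a).

Definition weyl : Type := {w : 'M[int]_n * 'M[int]_n | `[< in_weyl w >]}.

Definition to_weyl w (Hw : in_weyl w) : weyl :=
  exist (fun w => `[< in_weyl w >]) w (asboolT Hw).

Definition weyl_id : weyl := to_weyl in_weyl_id.

Lemma in_weyl_s a : a \in roots D -> in_weyl (refl_mx a, corefl_mx a).
Proof.
by move=> Ha; have := in_weyl_refl in_weyl_id Ha; rewrite /= !mul1mx.
Qed.

Definition weyl_s a (Ha : a \in roots D) : weyl :=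
  to_weyl (in_weyl_s Ha).

End Weyl.

(** e^{2 pi i x} *)
Definition e2pii {R : realType} (x : R[i]) : R[i] :=
  let r := expR (- (2 * pi * complex.Im x)) in
  let t := 2 * pi * complex.Re x in
  (r * cos t) +i* (r * sin t).

Definition theta {R : realType} (tau x : R[i]) : R[i] :=
  let q := e2pii tau in
  (0 +i* (2 * pi))^-1 * (e2pii (x / 2) - e2pii (- x / 2)) *
  limn ((fun N => \prod_(1 <= s < N)
    ((1 - q ^+ s * e2pii x) * (1 - q ^+ s * e2pii (- x)))) : nat -> R[i]^o) *
  (limn ((fun N => \prod_(1 <= s < N) (1 - q ^+ s)) : nat -> R[i]^o)) ^- 2.

(** The space (X_* (x) C) x (X^* (x) C), with points (z, lambda). *)
Definition univ_cover (R : realType) (n : nat) : normedModType R[i] :=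
  ('rV[R[i]]_n * 'rV[R[i]]_n)%type.

Section Meromorphic.
Context {R : realType} {n : nat}.
Local Notation V := (univ_cover R n).

Definition holomorphic_on (U : set V) (f : V -> R[i]) : Prop :=
  forall x : V, U x -> differentiable (f : V -> R[i]^o) x.

(** Meromorphic functions are represented by total functions whose values are
    irrelevant on the indeterminacy locus: locally [f] is a quotient of
    holomorphic functions, the denominator vanishing identically on no nonempty
    open set. *)
Definition meromorphic (f : V -> R[i]) : Prop :=
  forall p : V, exists (U : set V) (g h : V -> R[i]),
    [/\ open U /\ U p, holomorphic_on U g, holomorphic_on U h,
        (forall O : set V, open O -> O `<=` U -> O !=set0 ->
           exists2 x, O x & h x != 0)
      & forall x, U x -> h x != 0 -> f x = g x / h x].

(** Equality of meromorphic functions: agreement off a nowhere dense closed set,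
    so that values on the indeterminacy loci do not matter. *)
Definition mero_eq (f g : V -> R[i]) : Prop :=
  exists O : set V, [/\ open O, dense O & forall x, O x -> f x = g x].

End Meromorphic.

(** A line bundle is given by multipliers: its rational sections are the
    meromorphic functions invariant under X_* x X^*, multiplied by
    [mult_z m] under translation of z by tau m, m in X_*, and by [mult_l m]
    under translation of lambda by tau m, m in X^*. *)
Record line_bundle (R : realType) (n : nat) := LineBundle {
  mult_z : 'rV[int]_n -> univ_cover R n -> R[i];
  mult_l : 'rV[int]_n -> univ_cover R n -> R[i]
}.

Section Bundles.
Context {R : realType} {n : nat}.
Local Notation V := (univ_cover R n).

Definition cplx (x : 'rV[int]_n) : 'rV[R[i]]_n := map_mx intr x.

Definition rational_section (tau : R[i]) (M : line_bundle R n)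
    (f : V -> R[i]) : Prop :=
  [/\ meromorphic f,
      forall m, mero_eq (fun p => f (p.1 + cplx m, p.2)) f,
      forall m, mero_eq (fun p => f (p.1, p.2 + cplx m)) f,
      forall m, mero_eq (fun p => f (p.1 + tau *: cplx m, p.2))
                        (fun p => mult_z M m p * f p)
    & forall m, mero_eq (fun p => f (p.1, p.2 + tau *: cplx m))
                        (fun p => mult_l M m p * f p)].

Definition tensor (M N : line_bundle R n) : line_bundle R n :=
  LineBundle (fun m p => mult_z M m p * mult_z N m p)
             (fun m p => mult_l M m p * mult_l N m p).

Definition inverse (M : line_bundle R n) : line_bundle R n :=
  LineBundle (fun m p => (mult_z M m p)^-1) (fun m p => (mult_l M m p)^-1).

(** Pullback under (z, lambda) |-> (A z, B lambda). *)
Definition pull (A B : 'M[int]_n) (M : line_bundle R n) : line_bundle R n :=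
  let phi (p : V) : V := (p.1 *m map_mx intr A, p.2 *m map_mx intr B) in
  LineBundle (fun m p => mult_z M (m *m A) (phi p))
             (fun m p => mult_l M (m *m B) (phi p)).

End Bundles.

Section Twisted.
Context {R : realType} {n : nat} {D : root_datum n} (B : root_base D).
Context (tau hbar : R[i]).
Local Notation V := (univ_cover R n).
Local Notation W := (weyl D).

Definition rho : 'rV[R[i]]_n :=
  2^-1 *: \sum_(b <- roots D | `[< positive B b >]) cplx b.

Definition rho_vee : 'rV[R[i]]_n :=
  2^-1 *: \sum_(b <- roots D | `[< positive B b >]) cplx (coroot D b).

Definition bundle_L : line_bundle R n :=
  LineBundle
    (fun m p => e2pii (pairing D (p.2 + hbar *: rho) (cplx m)))
    (fun m p => e2pii (pairing D (cplx m) (p.1 - hbar *: rho_vee))).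

Definition pull_w (w : W) := @pull R n (val w).2 1%:M.
Definition pull_wV (w : W) := @pull R n (invmx (val w).2) 1%:M.
Definition pull_d (v : W) := @pull R n 1%:M (val v).1.
Definition pull_dV (v : W) := @pull R n 1%:M (invmx (val v).1).

Definition bundle_S (w v : W) : line_bundle R n :=
  tensor bundle_L (pull_wV w (pull_dV v (inverse bundle_L))).

Definition bundle_S' (w v : W) : line_bundle R n := pull_w w (bundle_S w v).

Definition bundle_S'' (w v : W) : line_bundle R n := pull_d v (bundle_S w v).

(** Rational sections of a direct sum over W x W: finitely supported families
    of rational sections of the summands. *)
Definition graded : Type := W -> W -> V -> R[i].

Definition rational_section_sum (S : W -> W -> line_bundle R n)
    (T : graded) : Prop :=
  (forall w v, rational_section tau (S w v) (T w v)) /\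
  finite_set [set wv | ~ mero_eq (T wv.1 wv.2) (fun=> 0)].

(** The function [a] placed in degree delta_w delta_v^d. *)
Definition homog (w v : W) (a : V -> R[i]) : graded :=
  fun w' v' p => if (w' == w) && (v' == v) then a p else 0.

Definition graded_add (S T : graded) : graded :=
  fun w v p => S w v p + T w v p.

Section Operators.
Context (i : 'I_(ss_rank B)).
Local Notation alpha := (simple B i).
Local Notation th := (theta tau).

Definition zc (p : V) : R[i] := pairing D (cplx alpha) p.1.
Definition lc (p : V) : R[i] := pairing D p.2 (cplx (coroot D alpha)).

Definition s_simple : W := weyl_s (simple_root i).

Definition DL : graded :=
  graded_add
    (homog (weyl_id D) s_simple (fun p =>
      (th hbar * th (zc p + lc p)) / (th (zc p) * th (hbar + lc p))))
    (homog s_simple s_simple (fun p =>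
      (th (hbar - zc p) * th (- lc p)) / (th (zc p) * th (hbar + lc p)))).

Definition DL_dual : graded :=
  graded_add
    (homog s_simple (weyl_id D) (fun p =>
      (th hbar * th (lc p + zc p)) / (th (lc p) * th (hbar - zc p))))
    (homog s_simple s_simple (fun p =>
      (th (hbar + lc p) * th (- zc p)) / (th (lc p) * th (hbar - zc p)))).

End Operators.
End Twisted.

(* Main.v *)
Require Import Defs.
From mathcomp Require Import all_boot all_order all_algebra.
From mathcomp Require Import finmap complex ring lra.
From mathcomp Require Import all_classical all_reals all_analysis.

Set Implicit Arguments.
Unset Strict Implicit.
Unset Printing Implicit Defensive.

Import Defs.
Import Order.TTheory GRing.Theory Num.Theory numFieldNormedType.Exports.
Import ComplexField Normc.

Local Open Scope classical_set_scope.
Local Open Scope complex_scope.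
Local Open Scope ring_scope.

(** Each of the two operators has exactly two homogeneous components, so four
    quotients of theta functions have to be recognized as rational sections of
    four line bundles; in every other degree the component is zero.

    All four coefficients have the shape
      theta(l1) theta(l2) / (theta(l3) theta(l4)),  l_j = c_j + x_j z_a + y_j l_a,
    with integers x_j, y_j, where z_a and l_a are the pairings of z with the
    simple root a and of lambda with its coroot.  Translating z by tau m turns
    l_j into l_j + x_j k tau with k = <a, m>, and
      theta(x + k tau) = e(k^2 (1 - tau)/2 - k x) theta(x),  e(x) = e^(2 pi i x).
    When x_1^2 + x_2^2 = x_3^2 + x_4^2 the quadratic exponents cancel, and the
    quotient is multiplied by e(- k (x_1 l1 + x_2 l2 - x_3 l3 - x_4 l4)); the
    same holds for lambda with the y_j.  This is [theta_quotient_section].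

    On the other side, the multipliers of the bundles are exponentials of
    pairings of z, lambda, rho and rho^vee with a lattice vector and its image
    under the reflection.  Because s_a moves a vector by a multiple of a, they
    depend on rho and rho^vee only through <rho, a^vee> and <a, rho^vee>, which
    are both 1 ([pairing_rho], [pairing_rho_vee]): s_a permutes the positive
    roots other than a.  For the coroots this needs s_a^vee(b^vee) = (s_a b)^vee
    ([coroot_refl]), which is derived here from the mere stability of the set of
    coroots by means of the invariant form y |-> sum_c <c, y> c.

    For meromorphy, theta is entire ([differentiable_theta]): the partial
    products of prod_s (1 - q^s u) have a Taylor remainder of order two which is
    bounded uniformly, so the limit is differentiable.  The denominators are
    nonzero on a dense set, since the zeros of theta satisfy e(x) = q^k and are
    thus isolated on every horizontal line ([theta_zero_isolated]). *)

(** * Root data: simple reflections, rho and its dual *)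

Section Pairing.
Context {K : comNzRingType} {n : nat} (P : 'M[int]_n).
Implicit Types (x y : 'rV[K]_n) (c : K).
Local Notation pr := (pairing_of P).

Lemma pairingDl x x' y : pr (x + x') y = pr x y + pr x' y.
Proof. by rewrite /pairing_of !mulmxDl mxE. Qed.

Lemma pairingDr x y y' : pr x (y + y') = pr x y + pr x y'.
Proof. by rewrite /pairing_of linearD mulmxDr mxE. Qed.

Lemma pairingZl c x y : pr (c *: x) y = c * pr x y.
Proof. by rewrite /pairing_of -!scalemxAl mxE. Qed.

Lemma pairingZr c x y : pr x (c *: y) = c * pr x y.
Proof. by rewrite /pairing_of linearZ -scalemxAr mxE. Qed.

Lemma pairingNl x y : pr (- x) y = - pr x y.
Proof. by rewrite -scaleN1r pairingZl mulN1r. Qed.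

Lemma pairingNr x y : pr x (- y) = - pr x y.
Proof. by rewrite -scaleN1r pairingZr mulN1r. Qed.

Lemma pairingBl x x' y : pr (x - x') y = pr x y - pr x' y.
Proof. by rewrite pairingDl pairingNl. Qed.

Lemma pairingBr x y y' : pr x (y - y') = pr x y - pr x y'.
Proof. by rewrite pairingDr pairingNr. Qed.

Lemma pairing_suml I (s : seq I) (Q : pred I) (F : I -> 'rV[K]_n) y :
  pr (\sum_(j <- s | Q j) F j) y = \sum_(j <- s | Q j) pr (F j) y.
Proof.
apply: (big_morph (fun x => pr x y)) => [x x'|]; first exact: pairingDl.
by rewrite -(scale0r 0) pairingZl mul0r.
Qed.

Lemma pairing_sumr I (s : seq I) (Q : pred I) (F : I -> 'rV[K]_n) x :
  pr x (\sum_(j <- s | Q j) F j) = \sum_(j <- s | Q j) pr x (F j).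
Proof.
apply: (big_morph (fun y => pr x y)) => [y y'|]; first exact: pairingDr.
by rewrite -(scale0r 0) pairingZr mul0r.
Qed.

End Pairing.

Lemma perm_map_involution (T : eqType) (s : seq T) (f : T -> T) : uniq s ->
  {in s, forall x, f x \in s} -> {in s, forall x, f (f x) = x} ->
  perm_eq (map f s) s.
Proof.
move=> us fs ff.
apply: uniq_perm => //.
  by rewrite map_inj_in_uniq// => x y xs ys e; rewrite -(ff x)// e ff.
move=> x; apply/mapP/idP => [[y ys ->]|xs]; first exact: fs.
by exists (f x); rewrite ?fs// ff.
Qed.

Section RootDatum.
Context {n : nat} (D : root_datum n).
Local Notation Phi := (roots D).
Local Notation "a ^v" := (coroot D a) (at level 2, format "a ^v").
Local Notation rf a := (pre_refl (pairing_mx D) a a^v).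
Local Notation crf a := (pre_corefl (pairing_mx D) a a^v).
Implicit Types (a b c x y : 'rV[int]_n).

Lemma refl_involutive a x : a \in Phi -> rf a (rf a x) = x.
Proof.
move=> aP; rewrite /pre_refl pairingBl pairingZl pairing_coroot//.
set p := pairing_of _ _ _; rewrite -addrA -opprD -scalerDl.
have -> : p + (p - p * 2) = 0 by ring.
by rewrite scale0r subr0.
Qed.

Lemma refl_adjoint a x y : pairing D (rf a x) y = pairing D x (crf a y).
Proof. by rewrite pairingBl pairingZl pairingBr pairingZr mulrC. Qed.

Lemma refl_self a : a \in Phi -> rf a a = - a.
Proof.
by move=> aP; rewrite /pre_refl pairing_coroot// scaler_nat mulr2n opprD addrA subrr add0r.
Qed.

Lemma corefl_self a : a \in Phi -> crf a a^v = - a^v.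
Proof.
by move=> aP; rewrite /pre_corefl pairing_coroot// scaler_nat mulr2n opprD addrA subrr add0r.
Qed.

(** Pairing with the coroot detects the coefficient, as <a, a^vee> = 2. *)
Lemma root_scale_eq0 a (k : int) : a \in Phi -> k *: a = 0 -> k = 0.
Proof.
move=> aP /(congr1 (fun x => pairing D x a^v)).
rewrite pairingZl pairing_coroot// -[0 in RHS](scale0r a) pairingZl mul0r.
by move/eqP; rewrite mulf_eq0 orbF => /eqP.
Qed.

(** The W-equivariant map from X_* to X^* that sends each coroot to a positive
    rational multiple of its root; it makes it possible to recover a root from
    its coroot. *)
Definition coweight_form y := \sum_(c <- Phi) pairing D c y *: c.

(** The sum defining the form is reindexed by s_a, which permutes the roots. *)
Lemma coweight_form_refl a y : a \in Phi ->
  rf a (coweight_form y) = coweight_form (crf a y).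
Proof.
move=> aP; have -> : rf a (coweight_form y) = \sum_(c <- Phi) pairing D c y *: rf a c.
  rewrite /pre_refl pairing_suml scaler_suml -sumrB; apply: eq_bigr => c _.
  by rewrite pairingZl scalerBr scalerA.
rewrite /coweight_form.
rewrite -[RHS](perm_big _ (@perm_map_involution _ Phi (rf a) _ _ _)) /=.
- rewrite big_map; apply: eq_bigr => c _.
  by rewrite -refl_adjoint refl_involutive.
- exact: fset_uniq.
- by move=> b bP; exact: refl_stable.
- by move=> b bP; exact: refl_involutive.
Qed.

Definition coroot_length y := pairing D (coweight_form y) y.

(** The length of y is the sum of the squares <c, y>^2, and the summand of c = a
    is 4. *)
Lemma coroot_length_gt0 a : a \in Phi -> 0 < coroot_length a^v.
Proof.
move=> aP; rewrite /coroot_length pairing_suml (big_fsetD1 a)//=.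
rewrite pairingZl pairing_coroot// ltr_pwDl//.
by apply: sumr_ge0 => b _; rewrite pairingZl -expr2 sqr_ge0.
Qed.

(** By equivariance, the image g of a^vee satisfies s_a g = - g, that is
    2 g = <g, a^vee> a. *)
Lemma coweight_form_coroot a : a \in Phi ->
  2 *: coweight_form a^v = coroot_length a^v *: a.
Proof.
move=> aP; have := coweight_form_refl a^v aP; rewrite corefl_self//.
have -> : coweight_form (- a^v) = - coweight_form a^v.
  by rewrite /coweight_form -sumrN; apply: eq_bigr => c _; rewrite pairingNr scaleNr.
move=> /eqP; rewrite subr_eq addrC -subr_eq opprK => /eqP <-.
by rewrite scaler_nat mulr2n.
Qed.

(** If c^vee = s_a^vee(b^vee), then [coweight_form] maps c^vee to a positive
    multiple of c, and also to a positive multiple of s_a b.  As the datum is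
    reduced, c is s_a b up to sign, and the sign is excluded by positivity. *)
Lemma coroot_refl a b : a \in Phi -> b \in Phi -> (rf a b)^v = crf a b^v.
Proof.
move=> aP bP; have [c cP cE] := corefl_stable aP bP; rewrite cE; congr (coroot D _).
have rP := refl_stable aP bP.
have e : coroot_length b^v *: rf a b = coroot_length c^v *: c.
  rewrite -(coweight_form_coroot cP) -cE -(coweight_form_refl _ aP).
  have rZ (k : int) x : rf a (k *: x) = k *: rf a x.
    by rewrite /pre_refl pairingZl scalerBr scalerA.
  by rewrite -!rZ (coweight_form_coroot bP).
have c0 := coroot_length_gt0 cP; have b0 := coroot_length_gt0 bP.
have [//|cN] := roots_reduced rP cP (lt0r_neq0 c0) e.
move: e; rewrite [X in _ = _ *: X]cN scalerN => /eqP; rewrite -subr_eq0 opprK -scalerDl => /eqP.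
by move/(root_scale_eq0 rP) => h; move: (addr_gt0 b0 c0); rewrite h.
Qed.

Section Base.
Context (B : root_base D) (i : 'I_(ss_rank B)).
Local Notation alpha := (simple B i).

Lemma sum_natz_simple (f : 'I_(ss_rank B) -> nat) :
  \sum_j (f j)%:Z *: simple B j = \sum_j simple B j *+ f j.
Proof. by apply: eq_bigr => j _; rewrite -scaler_nat natz. Qed.

(** Subtracting a multiple of alpha changes only the coefficient at alpha.  If
    s_alpha b were negative, all the other coefficients of b would vanish, and b
    would be a multiple of alpha, hence alpha itself. *)
Lemma refl_positive b : positive B b -> b != alpha -> positive B (rf alpha b).
Proof.
move=> [bP [c bE]] bN.
have aP := simple_root i.
have sP := refl_stable aP bP; split => //.
have [d [dE|dE]] := simple_span B sP; first by exists d.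
exfalso; move/eqP: bN; apply.
set k := pairing D b alpha^v in dE.
have cd : \sum_j ((c j + d j)%:Z - (if j == i then k else 0)) *: simple B j = 0.
  under eq_bigr => j _ do rewrite scalerBl PoszD scalerDl.
  rewrite sumrB big_split /=.
  have -> : \sum_j (if j == i then k else 0) *: simple B j = k *: alpha.
    by rewrite (bigD1 i)//= eqxx big1 ?addr0// => j /negbTE ->; rewrite scale0r.
  by rewrite !sum_natz_simple -bE addrAC -[b - _]/(rf alpha b) dE addNr.
have c0 j : j != i -> c j = 0%N.
  move=> /negbTE ji; have := simple_free cd j; rewrite ji subr0.
  by case=> /eqP; rewrite addn_eq0 => /andP[/eqP].
have bE' : (c i)%:Z *: alpha = 1 *: b.
  rewrite scale1r bE (bigD1 i)//= [X in _ + X]big1 ?addr0; last by move=> j ji; rewrite c0.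
  by rewrite -scaler_nat natz.
have [//|bN] := roots_reduced aP bP (oner_neq0 _) bE'.
move: bE'; rewrite bN scalerN scale1r => /eqP.
rewrite -subr_eq0 opprK -[X in _ + X]scale1r -scalerDl => /eqP/(root_scale_eq0 aP).
by rewrite -PoszD addn1.
Qed.

Let posroots := [seq b <- Phi | `[< positive B b >] && (b != alpha)].

Lemma positive_simple : positive B alpha.
Proof.
split; first exact: simple_root.
exists (fun j => (j == i) : nat); rewrite (bigD1 i)//= eqxx mulr1n big1 ?addr0//.
by move=> j /negbTE ->.
Qed.

(** The positive roots other than alpha are permuted, so they cancel in pairs. *)
Lemma sum_positive_odd (F : 'rV[int]_n -> int) :
  (forall b, b \in Phi -> F (rf alpha b) = - F b) ->
  \sum_(b <- Phi | `[< positive B b >]) F b = F alpha.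
Proof.
move=> Fodd; have aP := simple_root i.
rewrite -big_filter (bigD1_seq alpha) ?filter_uniq ?fset_uniq//=; last first.
  by rewrite mem_filter aP andbT; apply/asboolP/positive_simple.
rewrite big_filter_cond -big_filter -/posroots.
suff : \sum_(b <- posroots) F b = - \sum_(b <- posroots) F b.
  by move/eqP; rewrite -addr_eq0 -mulr2n mulrn_eq0 /= => /eqP ->; rewrite addr0.
rewrite -[LHS](perm_big _ (@perm_map_involution _ posroots (rf alpha) _ _ _)) /=.
- rewrite big_map -sumrN big_seq [RHS]big_seq; apply: eq_bigr => b.
  by rewrite mem_filter => /andP[_]; exact: Fodd.
- by rewrite filter_uniq ?fset_uniq.
- move=> b; rewrite !mem_filter => /andP[/andP[/asboolP bp bN] bP].
  rewrite refl_stable// andbT; apply/andP; split; first exact/asboolP/refl_positive.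
  apply/eqP => /(congr1 (rf alpha)); rewrite refl_involutive// refl_self// => bE.
  have [_ [c]] := bp; rewrite bE => cE.
  have cd : \sum_j ((c j)%:Z + (j == i)%:Z) *: simple B j = 0.
    under eq_bigr => j _ do rewrite scalerDl.
    rewrite big_split /= !sum_natz_simple -cE (bigD1 i)//= eqxx mulr1n.
    rewrite [X in _ + (_ + X)]big1 ?addr0 ?addNr//.
    by move=> j /negbTE ->.
  by have := simple_free cd i; rewrite eqxx -PoszD addn1.
- by move=> b; rewrite mem_filter => /andP[_ bP]; exact: refl_involutive.
Qed.

Lemma sum_positive_roots :
  \sum_(b <- Phi | `[< positive B b >]) pairing D b alpha^v = 2.
Proof.
have aP := simple_root i.
rewrite sum_positive_odd ?pairing_coroot// => b _.
by rewrite refl_adjoint corefl_self// pairingNr.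
Qed.

Lemma sum_positive_coroots :
  \sum_(b <- Phi | `[< positive B b >]) pairing D alpha b^v = 2.
Proof.
have aP := simple_root i.
rewrite sum_positive_odd ?pairing_coroot// => b bP.
by rewrite coroot_refl// -refl_adjoint refl_self// pairingNl.
Qed.

Section Complex.
Context {R : realType}.
Local Notation cplx := (@cplx R n).

Lemma pairing_cplx x y : pairing D (cplx x) (cplx y) = (pairing D x y)%:~R.
Proof.
rewrite /pairing_of /cplx map_trmx -!map_mxM mxE; congr (_ %:~R).
by congr ((_ *m _ *m _) _ _); apply/matrixP => k l; rewrite mxE intz.
Qed.

Lemma pairing_rho : pairing D (rho B) (cplx alpha^v) = 1 :> R[i].
Proof.
rewrite pairingZl pairing_suml; under eq_bigr do rewrite pairing_cplx.
by rewrite -(rmorph_sum intr) /= sum_positive_roots mulVf.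
Qed.

Lemma pairing_rho_vee : pairing D (cplx alpha) (rho_vee B) = 1 :> R[i].
Proof.
rewrite pairingZr pairing_sumr; under eq_bigr do rewrite pairing_cplx.
by rewrite -(rmorph_sum intr) /= sum_positive_coroots mulVf.
Qed.
End Complex.

End Base.

(** The square is 1 - 2 u v + u (v u) v. *)
Lemma reflection_mx_involutive (K : comNzRingType) m (u : 'cV[K]_m) (v : 'rV[K]_m) :
  v *m u = 2%:M -> (1%:M - u *m v) *m (1%:M - u *m v) = 1%:M.
Proof.
move=> vu; rewrite mulmxBl mul1mx mulmxBr mulmx1 mulmxA -(mulmxA u v u) vu.
by rewrite mul_mx_scalar -scalemxAl scaler_nat mulr2n opprB addrK subrK.
Qed.

Section ReflectionMatrices.
Context {R : realType} (a : 'rV[int]_n) (aP : a \in Phi).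
Local Notation cplx := (@cplx R n).

Lemma map_intr_mx m1 m2 (A : 'M[int]_(m1, m2)) : map_mx intr A = A.
Proof. by apply/matrixP => k l; rewrite mxE intz. Qed.

(** Rank one form of the reflection; unlike its action on integral vectors, it
    can be transported to complex coefficients. *)
Lemma refl_mxE : refl_mx D a = 1%:M - pairing_mx D *m (a^v)^T *m a.
Proof.
apply/matrixP => k l; rewrite !mxE big_ord1 /pairing_of map_intr_mx eqxx /=.
by rewrite -rowE -row_mul !mxE eq_sym.
Qed.

Lemma corefl_mxE : corefl_mx D a = 1%:M - (pairing_mx D)^T *m a^T *m a^v.
Proof.
apply/matrixP => k l; rewrite !mxE big_ord1 /pairing_of map_intr_mx eqxx /=.
by rewrite trmx_delta -colE -trmx_mul !mxE eq_sym.
Qed.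

Lemma mul_refl_mx (x : 'rV[R[i]]_n) :
  x *m map_mx intr (refl_mx D a) = x - pairing D x (cplx a^v) *: cplx a.
Proof.
rewrite refl_mxE map_mxB map_mx1 mulmxBr mulmx1 !map_mxM !mulmxA -map_trmx.
by rewrite [X in _ - X *m _]mx11_scalar mul_scalar_mx.
Qed.

Lemma mul_corefl_mx (y : 'rV[R[i]]_n) :
  y *m map_mx intr (corefl_mx D a) = y - pairing D (cplx a) y *: cplx a^v.
Proof.
rewrite corefl_mxE map_mxB map_mx1 mulmxBr mulmx1 !map_mxM !mulmxA -!map_trmx.
have -> : y *m (map_mx intr (pairing_mx D))^T *m (map_mx intr a)^T =
    (map_mx intr a *m map_mx intr (pairing_mx D) *m y^T)^T.
  by rewrite !trmx_mul trmxK mulmxA.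
by rewrite [X in _ - X *m _]mx11_scalar mul_scalar_mx mxE.
Qed.

Lemma refl_mx_involutive : refl_mx D a *m refl_mx D a = 1%:M.
Proof.
rewrite refl_mxE; apply: reflection_mx_involutive.
by rewrite [LHS]mx11_scalar -(pairing_coroot aP) /pairing_of map_intr_mx mulmxA.
Qed.

Lemma corefl_mx_involutive : corefl_mx D a *m corefl_mx D a = 1%:M.
Proof.
rewrite corefl_mxE; apply: reflection_mx_involutive.
have -> : a^v *m ((pairing_mx D)^T *m a^T) = (a *m pairing_mx D *m (a^v)^T)^T.
  by rewrite !trmx_mul trmxK.
by rewrite [LHS]mx11_scalar mxE -(pairing_coroot aP) /pairing_of map_intr_mx.
Qed.

Lemma invmx_refl_mx : invmx (refl_mx D a) = refl_mx D a.
Proof.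
have [u _] := mulmx1_unit refl_mx_involutive.
by rewrite -[RHS](mulKmx u) refl_mx_involutive mulmx1.
Qed.

Lemma invmx_corefl_mx : invmx (corefl_mx D a) = corefl_mx D a.
Proof.
have [u _] := mulmx1_unit corefl_mx_involutive.
by rewrite -[RHS](mulKmx u) corefl_mx_involutive mulmx1.
Qed.
End ReflectionMatrices.
End RootDatum.

(** * Norms and limits of complex numbers *)

Section Norm.
Context {R : realType}.
Implicit Types (x y : R[i]) (r : R).

Lemma norm_normc x : `|x| = (normc x)%:C. Proof. by []. Qed.

Lemma normc_ge0 x : 0 <= normc x.
Proof. by rewrite -lecR -norm_normc; exact: (@normr_ge0 _ R[i]). Qed.

Lemma gt0_Re x : 0 < x -> 0 < complex.Re x /\ x = (complex.Re x)%:C.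
Proof.
case: x => a b; rewrite ltcE /= => /andP[/eqP b0 a0]; split=> //.
by apply/eqP; rewrite eq_complex /= b0 !eqxx.
Qed.

Lemma normcX x n : normc (x ^+ n) = normc x ^+ n.
Proof.
elim: n => [|n IH]; first by rewrite !expr0 normc1.
by rewrite !exprS normcM IH.
Qed.

Lemma normc_Re x : `|complex.Re x| <= normc x.
Proof. by rewrite -lecR -norm_normc normc_ge_Re. Qed.

Lemma normc_Im x : `|complex.Im x| <= normc x.
Proof.
have := normc_Re (x * 'i%C).
by rewrite ReiNIm normrN normcM /= expr0n expr1n add0r sqrtr1 mulr1.
Qed.

Lemma normc_leD x : normc x <= `|complex.Re x| + `|complex.Im x|.
Proof.
case: x => a b /=.
rewrite -[leRHS]ger0_norm ?addr_ge0// -sqrtr_sqr ler_sqrt ?sqr_ge0//.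
rewrite -(real_normK (num_real a)) -(real_normK (num_real b)).
by have := normr_ge0 a; have := normr_ge0 b; nra.
Qed.

Lemma cvg_complex (u : nat -> R[i]) (a b : R) :
  (fun n => complex.Re (u n)) @ \oo --> a ->
  (fun n => complex.Im (u n)) @ \oo --> b ->
  (u : nat -> R[i]^o) @ \oo --> ((a +i* b) : R[i]^o).
Proof.
move=> /cvgrPdist_lt ca /cvgrPdist_lt cb.
apply/(@cvgrPdist_lt R[i] R[i]^o) => e e0.
have [e0' eE] := gt0_Re e0.
have := ca _ (divr_gt0 e0' (ltr0Sn _ 1)); have := cb _ (divr_gt0 e0' (ltr0Sn _ 1)).
apply: filterS2 => n hb ha; rewrite eE.
rewrite norm_normc ltcR (le_lt_trans (normc_leD _))//.
have -> : complex.Re e = complex.Re e / 2 + complex.Re e / 2 by field.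
by apply: ltrD; move: ha hb; case: (u n).
Qed.

(** Completeness is used on the real and imaginary parts separately. *)
Lemma cvg_geometric_increments (u : nat -> R[i]) (K r : R) :
  0 <= r < 1 -> (forall n, normc (u n.+1 - u n) <= K * r ^+ n) ->
  exists l : R[i], (u : nat -> R[i]^o) @ \oo --> (l : R[i]^o).
Proof.
move=> /andP[r0 r1] hu.
have real_cvg (v : nat -> R) : (forall n, `|v n.+1 - v n| <= K * r ^+ n) ->
    exists a : R, v @ \oo --> a.
  move=> hv; suff : cvgn v by move=> cv; exists (limn v).
  have -> : v = (fun n => v 0%N + series (telescope v) n).
    by apply/funext => n; rewrite -eq_sum_telescope.
  apply: is_cvgD; first exact: is_cvg_cst.
  apply: normed_cvg; apply: (@series_le_cvg _ _ (geometric K r)).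
  - by move=> n; exact: normr_ge0.
  - by move=> n; rewrite (le_trans _ (hv n)).
  - by move=> n; exact: hv.
  - by apply: is_cvg_geometric_series; rewrite ger0_norm.
have [a ha] : exists a : R, (fun n => complex.Re (u n)) @ \oo --> a.
  apply: real_cvg => n; apply: le_trans (hu n).
  by apply: le_trans (normc_Re _); case: (u n.+1) (u n) => ? ? [].
have [b hb] : exists a : R, (fun n => complex.Im (u n)) @ \oo --> a.
  apply: real_cvg => n; apply: le_trans (hu n).
  by apply: le_trans (normc_Im _); case: (u n.+1) (u n) => ? ? [].
by exists (a +i* b); exact: cvg_complex.
Qed.

Lemma closed_ball_lim (u : nat -> R[i]) (l : R[i]) (r : R) :
  (u : nat -> R[i]^o) @ \oo --> (l : R[i]^o) ->
  (forall n, normc (u n) <= r) -> normc l <= r.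
Proof.
move=> ul ur; apply/ler_addgt0Pr => e e0.
have e0' : 0 < e%:C by rewrite -[0]/(0%:C) ltcR.
move/(@cvgrPdist_lt R[i] R[i]^o): ul => /(_ _ e0') [N _ /(_ N (leqnn N))] /=.
rewrite norm_normc ltcR => lN.
have -> : l = u N + (l - u N) by rewrite addrC subrK.
by rewrite (le_trans (le_normcD _ _))// lerD// ltW.
Qed.

(** A remainder of order two gives the derivative d; it is enough to control it
    near x, and it is an estimate that survives passage to pointwise limits. *)
Lemma differentiable_quadratic (f : R[i] -> R[i]) (x d : R[i]) (r M : R) :
  0 < r ->
  (forall h, normc h <= r -> normc (f (x + h) - f x - h * d) <= M * normc h ^+ 2) ->
  differentiable (f : R[i]^o -> R[i]^o) (x : R[i]^o).
Proof.
move=> r0 hf.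
have M0 : 0 <= M.
  have := hf r%:C; rewrite /= expr0n addr0 sqrtr_sqr (ger0_norm (ltW r0)) => /(_ (lexx _)).
  by move=> /(le_trans (normc_ge0 _)); rewrite (pmulr_lge0 _ (exprn_gt0 2 r0)).
apply/derivable1_diffP.
apply/cvg_ex; exists d.
apply/cvgrPdist_le => e e0.
have [e0' eE] := gt0_Re e0.
set s := Num.min r (complex.Re e / (M + 1)).
have s0 : 0 < s by rewrite lt_min r0 divr_gt0// ltr_wpDl.
have s0' : 0 < s%:C by rewrite -[0]/(0%:C) ltcR.
exists s%:C => //= h; rewrite /ball_ /= sub0r normrN => hs h0.
rewrite eE norm_normc lecR.
move: hs; rewrite norm_normc ltcR lt_min => /andP[hr hM].
have := hf h (ltW hr) => hb.
have nh : 0 < normc h.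
  by rewrite lt_neqAle normc_ge0 andbT eq_sym; apply: contra h0 => /eqP/eq0_normc/eqP.
have -> : d - h^-1 *: (f (h *: 1 + x) - f x) =
  - (h^-1 * (f (x + h) - f x - h * d)).
  rewrite [h *: 1]mulr1 -[h^-1 *: _]/(h^-1 * _) (addrC h x).
  by rewrite (mulrBr _ _ (h * d)) mulKf// opprB.
rewrite normcN normcM normcV -ler_pdivlMl ?invr_gt0// invrK.
apply: le_trans hb _; rewrite expr2 mulrCA ler_pM2l//.
move: hM; rewrite ltr_pdivlMr ?ltr_wpDl// mulrDr mulr1 => hM.
by rewrite (le_trans _ (ltW hM))// mulrC lerDl normc_ge0.
Qed.
End Norm.

(** * The finite products of (1 - q^s u) *)

Section Product.
Context {R : realType}.
Implicit Types (q u h : R[i]).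

(** Partial products of the q-Pochhammer symbol (q u; q), as polynomials in u so
    that their formal derivative is at hand. *)
Definition pochhammer_poly q N : {poly R[i]} := \prod_(1 <= s < N) (1 - q ^+ s *: 'X).

Lemma pochhammer_poly1 q : pochhammer_poly q 1 = 1.
Proof. by rewrite /pochhammer_poly big_geq. Qed.

Lemma pochhammer_polyS q N :
  pochhammer_poly q N.+2 = pochhammer_poly q N.+1 * (1 - q ^+ N.+1 *: 'X).
Proof. by rewrite /pochhammer_poly big_nat_recr. Qed.

Lemma horner_pochhammer_poly q u N :
  (pochhammer_poly q N).[u] = \prod_(1 <= s < N) (1 - q ^+ s * u).
Proof. by rewrite horner_prod; apply: eq_bigr => s _; rewrite !hornerE. Qed.

Lemma horner_pochhammer_polyS q u N :
  (pochhammer_poly q N.+2).[u] = (pochhammer_poly q N.+1).[u] * (1 - q ^+ N.+1 * u).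
Proof. by rewrite pochhammer_polyS !hornerE. Qed.

Lemma horner_deriv_pochhammer_polyS q u N :
  (pochhammer_poly q N.+2)^`().[u] = (pochhammer_poly q N.+1)^`().[u] * (1 - q ^+ N.+1 * u)
     - q ^+ N.+1 * (pochhammer_poly q N.+1).[u].
Proof.
rewrite pochhammer_polyS derivM derivB derivZ derivX -polyC1 derivC sub0r.
by rewrite !hornerE mulrN [_ * q ^+ _]mulrC.
Qed.

(** The value, the derivative and the coefficient g of the remainder are bounded
    together: multiplying by 1 - c u multiplies the sum of the three bounds by at
    most 1 + |c| (|u| + 1), because in the recursion the terms |c| |value| and
    |c| |derivative| feed the next quantity. *)
Lemma pochhammer_poly_remainder q u h N : normc h <= 1 ->
  exists g : R, [/\ 0 <= g,
    normc ((pochhammer_poly q N.+1).[u + h] - (pochhammer_poly q N.+1).[u]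
       - h * (pochhammer_poly q N.+1)^`().[u]) <= g * normc h ^+ 2 &
    normc (pochhammer_poly q N.+1).[u] + normc (pochhammer_poly q N.+1)^`().[u] + g <=
      \prod_(1 <= s < N.+1) (1 + normc q ^+ s * (normc u + 1))].
Proof.
move=> h1; elim: N => [|N [g [g0 hg hM]]].
  exists 0; split => //.
    rewrite pochhammer_poly1 -polyC1 derivC !hornerE subrr subr0 ?normc0.
    by rewrite ?mul0r ?mulr0 ?subr0 ?normc0.
  by rewrite pochhammer_poly1 -polyC1 derivC !hornerE normc0 normc1 !addr0 big_geq.
rewrite !horner_pochhammer_polyS !horner_deriv_pochhammer_polyS big_nat_recr//=.
move: hg hM; set F := (_).[u]; set F' := (_).[u + h]; set d := (_).[u].
set P := \prod_(_ <= _ < _) _; set c := q ^+ N.+1 => hg hM.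
rewrite -(normcX q) -/c; set E := F' - F - h * d in hg.
have nu := normc_ge0 u; have nc := normc_ge0 c; have nh := normc_ge0 h.
have nF := normc_ge0 F; have nd := normc_ge0 d.
have B0 : 0 <= 1 + normc c * (normc u + 1) by rewrite addr_ge0// mulr_ge0// addr_ge0.
exists (g * (1 + normc c * (normc u + 1)) + normc c * normc d); split.
- by rewrite addr_ge0// mulr_ge0.
- have -> : F' * (1 - c * (u + h)) - F * (1 - c * u) - h * (d * (1 - c * u) - c * F)
     = E * (1 - c * (u + h)) - c * d * h ^+ 2 by rewrite /E; ring.
  apply: le_trans (le_normcD _ _) _; rewrite normcN normcM (normcM (c * d)).
  rewrite (normcX h) (normcM c) mulrDl lerD//.
  rewrite -mulrA [_ * normc h ^+ 2]mulrC mulrA; apply: ler_pM; rewrite ?normc_ge0//.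
  apply: le_trans (le_normcD _ _) _; rewrite normcN normc1 lerD2l normcM ler_wpM2l//.
  by apply: le_trans (le_normcD _ _) _; rewrite lerD2l.
have e1 : normc (1 - c * u) <= 1 + normc c * normc u.
  by apply: le_trans (le_normcD _ _) _; rewrite normcN normc1 normcM.
have e2 : normc (d * (1 - c * u) - c * F) <=
    normc d * (1 + normc c * normc u) + normc c * normc F.
  apply: le_trans (le_normcD _ _) _; rewrite normcN !normcM lerD2r.
  by rewrite ler_wpM2l.
have e3 : normc (F * (1 - c * u)) <= normc F * (1 + normc c * normc u).
  by rewrite normcM ler_wpM2l.
apply: le_trans (ler_wpM2r B0 hM).
apply: le_trans (lerD (lerD e3 e2) (lexx _)) _.
by rewrite le_eqVlt; apply/orP; left; apply/eqP; ring.
Qed.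

End Product.

(** * The infinite product of (1 - q^s u) *)

Section EulerProduct.
Context {R : realType}.
Context (q : R[i]) (q1 : normc q < 1).
Implicit Types (u h : R[i]).

(** From 1 + x <= exp x; the bound does not depend on N, which is what makes the
    estimates of the partial products uniform. *)
Lemma prod_geometric_bound (r : R) N : 0 <= r ->
  \prod_(1 <= s < N) (1 + normc q ^+ s * r) <= expR (r / (1 - normc q)).
Proof.
move=> r0; have q0 := normc_ge0 q.
apply: (@le_trans _ _ (expR (\sum_(1 <= s < N) normc q ^+ s * r))).
  rewrite expR_sum; apply: ler_prod => s _; rewrite expR_ge1Dx andbT.
  by rewrite addr_ge0// mulr_ge0// exprn_ge0.
rewrite ler_expR -mulr_suml mulrC; apply: ler_wpM2l => //.
rewrite -[leRHS]mul1r ler_pdivlMr ?subr_gt0//.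
have -> : (\sum_(1 <= s < N) normc q ^+ s) * (1 - normc q) =
   \sum_(1 <= s < N) (normc q ^+ s - normc q ^+ s.+1).
  by rewrite mulr_suml; apply: eq_bigr => s _; rewrite exprSr; ring.
case: N => [|N]; first by rewrite big_geq.
under eq_bigr do rewrite -opprB; rewrite sumrN telescope_sumr// expr1 opprB.
by rewrite lerBlDr (le_trans (ltW q1))// lerDl exprn_ge0.
Qed.

Definition pochhammer u : R[i] :=
  limn ((fun N => \prod_(1 <= s < N) (1 - q ^+ s * u)) : nat -> R[i]^o).

Let M u := expR ((normc u + 1) / (1 - normc q)).

Let bounds u N : normc (pochhammer_poly q N.+1).[u] <= M u /\
  normc (pochhammer_poly q N.+1)^`().[u] <= M u.
Proof.
have u1 : 0 <= normc u + 1 by rewrite addr_ge0 ?normc_ge0.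
have h0 : normc (0 : R[i]) <= 1 by rewrite normc0.
have [g [g0 _ hM]] := pochhammer_poly_remainder q u N h0.
have := le_trans hM (prod_geometric_bound N.+1 u1); rewrite -/(M u).
have := normc_ge0 (pochhammer_poly q N.+1).[u].
have := normc_ge0 (pochhammer_poly q N.+1)^`().[u].
by split; lra.
Qed.

Lemma cvg_prod_pochhammer_poly u (l : R[i]) :
  (fun N => (pochhammer_poly q N.+1).[u] : R[i]^o) @ \oo --> (l : R[i]^o) ->
  (fun N => \prod_(1 <= s < N) (1 - q ^+ s * u) : R[i]^o) @ \oo --> (l : R[i]^o).
Proof.
move=> hl; rewrite -cvg_shiftS.
have -> : (fun N => \prod_(1 <= s < N.+1) (1 - q ^+ s * u)) =
  (fun N => (pochhammer_poly q N.+1).[u]).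
  by apply/funext => N; rewrite horner_pochhammer_poly.
exact: hl.
Qed.

(** The derivatives converge too, directly from their own recursion, so their
    limit is a candidate for the derivative of the infinite product. *)
Lemma pochhammer_poly_cvg u :
   exists2 d : R[i],
     (fun N => (pochhammer_poly q N.+1).[u] : R[i]^o) @ \oo --> (pochhammer u : R[i]^o) &
     (fun N => (pochhammer_poly q N.+1)^`().[u] : R[i]^o) @ \oo --> (d : R[i]^o).
Proof.
have q01 : 0 <= normc q < 1 by rewrite normc_ge0.
have [l hl] : exists l : R[i],
    (fun N => (pochhammer_poly q N.+1).[u] : R[i]^o) @ \oo --> (l : R[i]^o).
  apply: (@cvg_geometric_increments _ _ (M u * normc u) (normc q)) => // n.
  rewrite horner_pochhammer_polyS mulrBr mulr1 addrC addKr normcN !normcM normcX.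
  rewrite exprS [normc q * _]mulrC -!mulrA ler_pM ?normc_ge0 ?mulr_ge0 ?exprn_ge0 ?normc_ge0//.
    by have [] := bounds u n.
  rewrite [leRHS]mulrC ler_wpM2l ?exprn_ge0 ?normc_ge0//.
  by rewrite ler_piMl ?normc_ge0// ltW.
have [d hd] : exists l : R[i],
    (fun N => (pochhammer_poly q N.+1)^`().[u] : R[i]^o) @ \oo --> (l : R[i]^o).
  apply: (@cvg_geometric_increments _ _ (M u * (normc u + 1)) (normc q)) => // n.
  rewrite horner_deriv_pochhammer_polyS.
  have [b1 b2] := bounds u n; move: b1 b2.
  set F := (_).[u]; set d := (_).[u] => b1 b2.
  have -> : d * (1 - q ^+ n.+1 * u) - q ^+ n.+1 * F - d =
            - (q ^+ n * (q * (d * u + F))) by rewrite exprS; ring.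
  rewrite normcN normcM normcX mulrC ler_wpM2r ?exprn_ge0 ?normc_ge0//.
  rewrite normcM -[leRHS]mul1r ler_pM ?normc_ge0 ?(ltW q1)//.
  apply: le_trans (le_normcD _ _) _; rewrite mulrDr mulr1 lerD// normcM.
  by rewrite ler_wpM2r ?normc_ge0.
exists d; last exact: hd.
suff -> : pochhammer u = l by exact: hl.
apply: (@cvg_lim R[i]^o); first exact: norm_hausdorff.
exact: cvg_prod_pochhammer_poly.
Qed.

Lemma cvg_pochhammer u :
  (fun N => \prod_(1 <= s < N) (1 - q ^+ s * u) : R[i]^o) @ \oo -->
  (pochhammer u : R[i]^o).
Proof.
have [d hl _] := pochhammer_poly_cvg u.
exact: cvg_prod_pochhammer_poly.
Qed.

(** Limit of [pochhammer_poly_remainder] for a fixed h. *)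
Lemma pochhammer_quadratic u : exists d : R[i], forall h, normc h <= 1 ->
  normc (pochhammer (u + h) - pochhammer u - h * d) <= M u * normc h ^+ 2.
Proof.
have [d hu hd] := pochhammer_poly_cvg u.
exists d => h h1; have [d' hh _] := pochhammer_poly_cvg (u + h).
apply: (@closed_ball_lim _ (fun N => (pochhammer_poly q N.+1).[u + h]
   - (pochhammer_poly q N.+1).[u] - h * (pochhammer_poly q N.+1)^`().[u])).
  apply: (@cvgB R[i] R[i]^o).
    by apply: (@cvgB R[i] R[i]^o); [exact: hh | exact: hu].
  by apply: (@cvgM R[i]); [exact: cvg_cst | exact: hd].
move=> N; have [g [g0 hg hM]] := pochhammer_poly_remainder q u N h1.
apply: le_trans hg _; apply: ler_wpM2r; first by rewrite exprn_ge0 ?normc_ge0.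
have u1 : 0 <= normc u + 1 by rewrite addr_ge0 ?normc_ge0.
have := le_trans hM (prod_geometric_bound N.+1 u1); rewrite -/(M u).
have := normc_ge0 (pochhammer_poly q N.+1).[u].
have := normc_ge0 (pochhammer_poly q N.+1)^`().[u].
by lra.
Qed.

Lemma differentiable_pochhammer u :
  differentiable (pochhammer : R[i]^o -> R[i]^o) (u : R[i]^o).
Proof.
have [d hd] := pochhammer_quadratic u.
exact: (differentiable_quadratic ltr01 hd).
Qed.

Lemma pochhammer_shift u : pochhammer u = (1 - q * u) * pochhammer (q * u).
Proof.
apply: (@cvg_lim R[i]^o); first exact: norm_hausdorff.
rewrite -cvg_shiftS -cvg_shiftS.
have -> : (fun n => \prod_(1 <= s < n.+2) (1 - q ^+ s * u)) =
  (fun n => (1 - q * u) * \prod_(1 <= s < n.+1) (1 - q ^+ s * (q * u))).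
  apply/funext => n; rewrite big_nat_recl//= expr1; congr (_ * _).
  by apply: eq_bigr => s _; rewrite exprSr mulrA.
apply: (@cvgM R[i]); first exact: cvg_cst.
by have := @cvg_pochhammer (q * u); rewrite -cvg_shiftS.
Qed.

Lemma pochhammer0 : pochhammer 0 = 1.
Proof.
apply: (@cvg_lim R[i]^o); first exact: norm_hausdorff.
have -> : (fun N => \prod_(1 <= s < N) (1 - q ^+ s * 0)) = fun=> (1 : R[i]^o).
  by apply/funext => n; rewrite big1// => s _; rewrite mulr0 subr0.
exact: cvg_cst.
Qed.

(** [pochhammer_shift] reduces the claim from u to q^n u, which tends to 0, where
    the product is continuous with value 1. *)
Lemma pochhammer_neq0 u :
  (forall s, (0 < s)%N -> q ^+ s * u != 1) -> pochhammer u != 0.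
Proof.
move=> hu.
have red n : pochhammer (q ^+ n * u) != 0 -> pochhammer u != 0.
  elim: n => [|n IH]; first by rewrite expr0 mul1r.
  move=> h; apply: IH; rewrite pochhammer_shift mulrA -exprS mulf_neq0//.
  by rewrite subr_eq0 eq_sym hu.
have : continuous_at (0 : R[i]^o) (pochhammer : R[i]^o -> R[i]^o).
  exact/differentiable_continuous/differentiable_pochhammer.
have c0 : (fun n => (q ^+ n * u : R[i]^o)) @ \oo --> (0 : R[i]^o).
  rewrite -[X in _ --> X](mul0r u); apply: (@cvgM R[i]); last exact: cvg_cst.
  apply/(@cvgrPdist_lt R[i] R[i]^o) => e e0.
  have [e0' eE] := gt0_Re e0.
  have /cvgrPdist_lt/(_ _ e0') : GRing.exp (normc q) @ \oo --> 0.
    by apply: cvg_expr; rewrite ger0_norm ?normc_ge0.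
  apply: filterS => n; rewrite !sub0r normrN eE norm_normc ltcR normcN normcX.
  by rewrite ger0_norm ?exprn_ge0 ?normc_ge0.
move=> /(continuous_cvg _) /(_ c0).
rewrite pochhammer0 => /(@cvgrPdist_lt R[i] R[i]^o) /(_ _ ltr01) [N _ /(_ N (leqnn N))] /=.
move=> hN; apply: (red N); apply: contraTneq hN => ->.
by rewrite subr0 normr1 ltxx.
Qed.
End EulerProduct.

(** * The function e^(2 pi i x) *)

Section Exponential.
Context {R : realType}.
Implicit Types (x y h : R[i]) (s t : R).

Lemma e2piiD x y : e2pii (x + y) = e2pii x * e2pii y.
Proof.
case: x y => a b [c d]; rewrite /e2pii /=.
rewrite !mulrDr opprD expRD sinD cosD.
by apply/eqP; rewrite eq_complex /=; apply/andP; split; apply/eqP; ring.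
Qed.

Lemma e2pii0 : e2pii 0 = 1 :> R[i].
Proof. by rewrite /e2pii /= !mulr0 oppr0 expR0 cos0 sin0 mulr1 mulr0. Qed.

Lemma normc_e2pii x : normc (e2pii x) = expR (- (2 * pi * complex.Im x)).
Proof.
by rewrite /e2pii /= !exprMn -mulrDr cos2Dsin2 mulr1 sqrtr_sqr ger0_norm// expR_ge0.
Qed.

Lemma e2pii_neq0 x : e2pii x != 0.
Proof.
apply/eqP => /(congr1 (@normc R)); rewrite normc_e2pii normc0 => /eqP.
by rewrite expR_eq0.
Qed.

Lemma e2piiN x : e2pii (- x) = (e2pii x)^-1.
Proof.
by apply: (mulfI (e2pii_neq0 x)); rewrite -e2piiD subrr e2pii0 divff ?e2pii_neq0.
Qed.

Lemma e2pii_half : e2pii (2^-1) = -1 :> R[i].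
Proof.
have -> : (2^-1 : R[i]) = (2^-1 : R) +i* 0.
  by rewrite -[RHS]/((2^-1 : R)%:C) rmorphV ?unitfE// rmorph_nat.
rewrite /e2pii /= mulr0 oppr0 expR0 !mul1r mulrAC mulfV// mul1r cospi sinpi.
by apply/eqP; rewrite eq_complex /= oppr0 !eqxx.
Qed.

Lemma e2piiMz x (m : int) : e2pii (x *~ m) = e2pii x ^ m.
Proof.
have nat_case n : e2pii (x *+ n) = e2pii x ^+ n.
  by elim: n => [|n IH]; rewrite ?mulr0n ?e2pii0// mulrS exprS e2piiD IH.
case: m => n; first exact: nat_case.
by rewrite [in LHS]NegzE mulrNz e2piiN nat_case.
Qed.

Lemma e2pii1 : e2pii 1 = 1 :> R[i].
Proof. by rewrite [X in e2pii X](splitr 1) e2piiD div1r e2pii_half mulrNN mulr1. Qed.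

(** The imaginary part of e(s) is sin (2 pi s), with 0 < 2 pi s < pi. *)
Lemma e2pii_real_inj x (s : R) : 0 < s < 2^-1 -> e2pii (x + s%:C) != e2pii x.
Proof.
move=> /andP[s0 s1]; rewrite e2piiD -[X in _ != X]mulr1.
rewrite (inj_eq (mulfI (e2pii_neq0 x))).
rewrite /e2pii /= mulr0 oppr0 expR0 !mul1r eq_complex /= negb_and orbC.
apply/orP; left; rewrite gt_eqF//; apply: sin_gt0_pi.
have p0 := pi_gt0 R; rewrite !mulr_gt0//=.
by rewrite -ltr_pdivlMl ?mulr_gt0// invfM -mulrA mulVf ?gt_eqF// mulr1.
Qed.

Lemma mvt_bound (f df : R -> R) (C t : R) : f 0 = 0 ->
  (forall u : R, is_derive u (1 : R) f (df u)) ->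
  (forall u : R, `|u| <= `|t| -> `|df u| <= C) -> `|f t| <= C * `|t|.
Proof.
move=> f0 hd hC.
have cf (A : set R) : {within A, continuous f}.
  apply: continuous_subspaceT => u.
  by apply/differentiable_continuous/derivable1_diffP; case: (hd u).
have [t0|t0] := leP 0 t.
  have [c] := MVT_segment t0 (fun u _ => hd u) (cf _).
  rewrite in_itv /= => /andP[c0 ct]; rewrite f0 !subr0 => ->.
  by rewrite normrM ler_wpM2r// hC// !ger0_norm.
have [c] := MVT_segment (ltW t0) (fun u _ => hd u) (cf _).
rewrite in_itv /= => /andP[tc c0]; rewrite f0 !sub0r mulrN => /oppr_inj ->.
by rewrite normrM ler_wpM2r// hC// !ler0_norm ?(ltW t0)// lerN2.
Qed.

Lemma cos_quadratic t : `|cos t - 1| <= `|t| ^+ 2.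
Proof.
have sin_le (u : R) : `|sin u| <= `|u|.
  rewrite -[leRHS]mul1r; apply: (@mvt_bound (@sin R) cos); first exact: sin0.
  by move=> v _; exact: cos_max.
rewrite expr2; apply: (@mvt_bound (fun u => cos u - 1) (fun u => - sin u)).
- by rewrite cos0 subrr.
- by move=> u; apply: is_derive_eq; rewrite subr0.
- by move=> u ut; rewrite normrN (le_trans (sin_le u)).
Qed.

Lemma sin_quadratic t : `|t| <= 1 -> `|sin t - t| <= `|t| ^+ 2.
Proof.
move=> t1.
rewrite expr2; apply: (@mvt_bound (fun u => sin u - u) (fun u => cos u - 1)).
- by rewrite sin0 subrr.
- move=> u ut; rewrite (le_trans (cos_quadratic u))// (le_trans _ ut)//.
  by rewrite expr2 ler_piMr// (le_trans ut).
Qed.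

Lemma expR_lipschitz s : `|s| <= 1 -> `|expR s - 1| <= expR 1 * `|s|.
Proof.
move=> s1.
apply: (@mvt_bound (fun u => expR u - 1) expR).
- by rewrite expR0 subrr.
- by move=> u; apply: is_derive_eq; rewrite subr0.
- move=> u us; rewrite ger0_norm ?expR_ge0// ler_expR.
  by rewrite (le_trans (ler_norm _))// (le_trans us).
Qed.

Lemma expR_quadratic s : `|s| <= 1 -> `|expR s - 1 - s| <= expR 1 * `|s| ^+ 2.
Proof.
move=> s1.
rewrite expr2 mulrA; apply: (@mvt_bound (fun u => expR u - 1 - u) (fun u => expR u - 1)).
- by rewrite expR0 subrr subr0.
- move=> u; have h : is_derive u (1 : R) (fun v => expR v - 1) (expR u).
    by apply: is_derive_eq; rewrite subr0.
  exact: (is_deriveB h (is_derive_id u (1 : R))).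
- move=> u us; rewrite (le_trans (expR_lipschitz _))// ?(le_trans us)//.
  by rewrite ler_wpM2l ?expR_ge0.
Qed.

(** With E = exp(- 2 pi Im h) and t = 2 pi Re h, the real part of the remainder
    is E (cos t - 1) + (E - 1 + 2 pi Im h) and its imaginary part is
    E (sin t - t) + (E - 1) t; each of the four terms is of order two. *)
Lemma e2pii_quadratic h : normc h <= (2 * pi)^-1 ->
  normc (e2pii h - 1 - h * (0 +i* (2 * pi))) <=
    4 * expR 1 * (2 * pi) ^+ 2 * normc h ^+ 2.
Proof.
have p0 : 0 < 2 * pi :> R by rewrite mulr_gt0 ?pi_gt0.
rewrite -[X in _ <= X]mul1r ler_pdivlMr// mulrC => n1.
set n := 2 * pi * normc h in n1 *.
case: h @n n1 => a b n n1.
set s := - (2 * pi * b); set t := 2 * pi * a.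
have sn : `|s| <= n.
  by rewrite normrN normrM gtr0_norm// ler_wpM2l ?(ltW p0)// (normc_Im (a +i* b)).
have tn : `|t| <= n.
  by rewrite normrM gtr0_norm// ler_wpM2l ?(ltW p0)// (normc_Re (a +i* b)).
have -> : e2pii (a +i* b) - 1 - (a +i* b) * (0 +i* (2 * pi)) =
    (expR s * (cos t - 1) + (expR s - 1 - s)) +i*
    (expR s * (sin t - t) + (expR s - 1) * t).
  by apply/eqP; rewrite eq_complex /= -/s -/t /s /t; apply/andP; split; apply/eqP; ring.
have E1 : expR s <= expR 1.
  by rewrite ler_expR (le_trans (ler_norm _))// (le_trans sn).
have E0 := expR_ge0 s; have e0 := expR_ge0 (1 : R).
have n0 : 0 <= n by apply: le_trans sn.
have sq (u : R) : `|u| <= n -> `|u| ^+ 2 <= n ^+ 2 by move=> un; rewrite lerXn2r ?nnegrE.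
have c1 : `|expR s * (cos t - 1)| <= expR 1 * n ^+ 2.
  rewrite normrM ger0_norm// ler_pM//.
  exact: le_trans (cos_quadratic t) (sq _ tn).
have c2 : `|expR s - 1 - s| <= expR 1 * n ^+ 2.
  apply: le_trans (expR_quadratic (le_trans sn n1)) _.
  by rewrite ler_wpM2l ?sq.
have c3 : `|expR s * (sin t - t)| <= expR 1 * n ^+ 2.
  rewrite normrM ger0_norm// ler_pM//.
  exact: le_trans (sin_quadratic (le_trans tn n1)) (sq _ tn).
have c4 : `|(expR s - 1) * t| <= expR 1 * n ^+ 2.
  rewrite normrM expr2 mulrA ler_pM//.
  apply: le_trans (expR_lipschitz (le_trans sn n1)) _.
  by rewrite ler_wpM2l.
rewrite -mulrA -exprMn -/n -mulrA.
apply: le_trans (normc_leD _) _; rewrite /complex.Re /complex.Im.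
apply: le_trans (lerD (ler_normD _ _) (ler_normD _ _)) _.
have : 0 <= expR 1 * n ^+ 2 by rewrite mulr_ge0// exprn_ge0.
by move: c1 c2 c3 c4; set X := expR 1 * n ^+ 2; lra.
Qed.

Lemma differentiable_e2pii x :
  differentiable (e2pii : R[i]^o -> R[i]^o) (x : R[i]^o).
Proof.
have p0 : 0 < (2 * pi)^-1 :> R by rewrite invr_gt0 mulr_gt0 ?pi_gt0.
apply: (@differentiable_quadratic _ _ _ (e2pii x * (0 +i* (2 * pi))) _
  (normc (e2pii x) * (4 * expR 1 * (2 * pi) ^+ 2)) p0) => h hh.
have -> : e2pii (x + h) - e2pii x - h * (e2pii x * (0 +i* (2 * pi))) =
  e2pii x * (e2pii h - 1 - h * (0 +i* (2 * pi))) by rewrite e2piiD; ring.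
by rewrite normcM -[X in _ <= X]mulrA ler_wpM2l ?normc_ge0// e2pii_quadratic.
Qed.
End Exponential.

(** * The theta function *)

Section Theta.
Context {R : realType} (tau : R[i]) (tau_im : 0 < complex.Im tau).
Implicit Types (x : R[i]) (k m : int).
Local Notation q := (e2pii tau).
Local Notation th := (theta tau).

Lemma normc_nome : 0 < normc q < 1.
Proof.
rewrite normc_e2pii expR_gt0 expR_lt1 oppr_lt0.
by rewrite !mulr_gt0// pi_gt0.
Qed.

Let q1 : normc q < 1. Proof. by case/andP: normc_nome. Qed.

Definition theta_const := (0 +i* (2 * pi))^-1 * pochhammer q 1 ^- 2.

(** The three infinite products of theta in terms of a single function of one
    variable. *)
Lemma thetaE x : th x =
  theta_const * (e2pii (x / 2) - e2pii (- (x / 2))) *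
  (pochhammer q (e2pii x) * pochhammer q (e2pii (- x))).
Proof.
rewrite /theta mulNr.
set l1 := limn _; set l2 := limn _.
have -> : l1 = pochhammer q (e2pii x) * pochhammer q (e2pii (- x)).
  apply: (@cvg_lim R[i]^o); first exact: norm_hausdorff.
  have -> : (fun N => \prod_(1 <= s < N)
      ((1 - q ^+ s * e2pii x) * (1 - q ^+ s * e2pii (- x)))) =
    (fun N => (\prod_(1 <= s < N) (1 - q ^+ s * e2pii x)) *
       \prod_(1 <= s < N) (1 - q ^+ s * e2pii (- x))).
    by apply/funext => N; rewrite big_split.
  by apply: (@cvgM R[i]); apply: cvg_pochhammer.
have -> : l2 = pochhammer q 1.
  rewrite /l2 /pochhammer; congr (limn _).
  by apply/funext => N; apply: eq_bigr => s _; rewrite mulr1.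
by rewrite /theta_const; ring.
Qed.

Lemma nome_power_neq1 s : (0 < s)%N -> q ^+ s != 1.
Proof.
move=> s0; apply: contraTneq q1 => /(congr1 (@normc R)).
rewrite normcX normc1 => qs; rewrite -leNgt.
by rewrite -(ler_pXn2r s0) ?nnegrE ?normc_ge0// qs expr1n.
Qed.

Lemma theta_const_neq0 : theta_const != 0.
Proof.
rewrite mulf_neq0// invr_neq0 ?expf_neq0//; last first.
  by apply: pochhammer_neq0 => // s s0; rewrite mulr1 nome_power_neq1.
by rewrite eq_complex /= eqxx /= mulf_neq0// gt_eqF// pi_gt0.
Qed.

Lemma thetaN x : th (- x) = - th x.
Proof. by rewrite !thetaE mulNr !opprK; ring. Qed.

Lemma theta_int x m : th (x + m%:~R) = (-1) ^ m * th x.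
Proof.
have th1 y : th (y + 1) = - th y.
  rewrite !thetaE mulrDl opprD [- (y + 1)]opprD !e2piiD !e2piiN div1r e2pii_half e2pii1.
  by rewrite invrN invr1 !mulr1; ring.
have nat_case n y : th (y + n%:R) = (-1) ^+ n * th y.
  elim: n y => [|n IH] y; first by rewrite addr0 mul1r.
  by rewrite -addn1 natrD addrA th1 IH exprD; ring.
case: m => n; first exact: nat_case.
have := nat_case n.+1 (x - n.+1%:R); rewrite subrK => ->.
by rewrite NegzE mulrNz mulrA -exprnN mulVf ?mul1r// expf_neq0// oppr_eq0 oner_neq0.
Qed.

(** One step uses [pochhammer_shift] at e(x) and at e(- x - tau): the two factors
    1 - q e(x) and 1 - e(- x) account for the change of e(x/2) - e(- x/2).  Negative k are
    reached through the oddness of theta. *)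
Lemma theta_tau x k :
  th (x + k%:~R * tau) =
    (-1) ^ k * e2pii (- (tau / 2 * k%:~R ^+ 2)) * e2pii (- (k%:~R * x)) * th x.
Proof.
have th1 y : th (y + tau) = - e2pii (- (tau / 2)) * e2pii (- y) * th y.
  rewrite !thetaE [pochhammer q (e2pii y)]pochhammer_shift//.
  have -> : e2pii (y + tau) = q * e2pii y by rewrite addrC e2piiD.
  rewrite [pochhammer q (e2pii (- (_ + tau)))]pochhammer_shift//.
  have -> : q * e2pii (- (y + tau)) = e2pii (- y).
    by rewrite -e2piiD; congr e2pii; ring.
  have -> : (y + tau) / 2 = y / 2 + tau / 2 by ring.
  have qE : q = e2pii (tau / 2) * e2pii (tau / 2) by rewrite -e2piiD -splitr.
  have yE : e2pii y = e2pii (y / 2) * e2pii (y / 2) by rewrite -e2piiD -splitr.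
  move: (pochhammer _ _) (pochhammer _ _) => F G.
  rewrite !e2piiN !e2piiD qE yE.
  move: theta_const (e2pii_neq0 (y / 2)) (e2pii_neq0 (tau / 2)).
  by move: (e2pii (y / 2)) (e2pii (tau / 2)) => v w c v0 w0; field; rewrite v0.
have nat_case n y : th (y + n%:R * tau) = (-1) ^+ n *
    e2pii (- (tau / 2 * n%:R ^+ 2)) * e2pii (- (n%:R * y)) * th y.
  elim: n y => [|n IH] y.
    by rewrite !mul0r expr0n mulr0 oppr0 e2pii0 addr0 !mulr1 mul1r.
  have -> : y + n.+1%:R * tau = y + n%:R * tau + tau by rewrite mulrS; ring.
  rewrite th1 IH (exprS (-1)).
  have -> : e2pii (- (tau / 2 * n.+1%:R ^+ 2)) = e2pii (- (tau / 2)) *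
       e2pii (- (n%:R * tau)) * e2pii (- (tau / 2 * n%:R ^+ 2)).
    by rewrite -!e2piiD; congr e2pii; rewrite mulrS; field.
  have -> : e2pii (- (n.+1%:R * y)) = e2pii (- y) * e2pii (- (n%:R * y)).
    by rewrite -!e2piiD; congr e2pii; rewrite mulrS; ring.
  by rewrite opprD e2piiD; ring.
case: k => n; first exact: nat_case.
have -> : x + (Negz n)%:~R * tau = - (- x + n.+1%:R * tau).
  by rewrite NegzE mulrNz -[n.+1%:~R]/(n.+1%:R) mulNr opprD opprK.
rewrite thetaN nat_case thetaN NegzE mulrNz sqrrN !mulNr !mulrN opprK opprK.
by rewrite -exprnN -exprVn invrN1.
Qed.

(** Since k and k^2 have the same parity, the sign can be absorbed in a quadratic
    exponent. *)
Lemma sign_e2pii k : (-1) ^ k = e2pii (k%:~R ^+ 2 / 2) :> R[i].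
Proof.
have -> : k%:~R ^+ 2 / 2 = 2^-1 *~ (k * k) :> R[i].
  by rewrite -[RHS]mulrzr intrM mulrC expr2.
rewrite e2piiMz e2pii_half -exprz_exp.
have : (-1 : R[i]) ^ k * (-1) ^ k = 1 by rewrite -expfzMl mulrNN mulr1 exp1rz.
move/eqP; rewrite -expr2 sqrf_eq1 => /orP[/eqP h|/eqP h].
  by rewrite h exp1rz.
by rewrite h h.
Qed.

(** In this form and the next one the dependence on the square of the integer is
    isolated, so that it cancels from suitable quotients. *)
Lemma theta_shift_int x m : th (x + m%:~R) = e2pii (m%:~R ^+ 2 / 2) * th x.
Proof. by rewrite theta_int sign_e2pii. Qed.

Lemma theta_shift_tau x k : th (x + k%:~R * tau) =
  e2pii (k%:~R ^+ 2 * ((1 - tau) / 2) - k%:~R * x) * th x.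
Proof.
by rewrite theta_tau sign_e2pii -!e2piiD; congr (e2pii _ * _); field.
Qed.

(** A product of nonzero factors that converges is nonzero, so some factor vanishes. *)
Lemma theta_eq0 x : th x = 0 -> exists k, e2pii x = q ^ k.
Proof.
move=> /eqP; rewrite thetaE 2!mulf_eq0 (negbTE theta_const_neq0) mulf_eq0 /=.
case/or3P => [/eqP h|/eqP h|/eqP h].
- exists 0; rewrite expr0z [X in e2pii X](splitr x) e2piiD.
  by rewrite {1}(subr0_eq h) -e2piiD addNr e2pii0.
- apply: contrapT => /forallNP hk; move/eqP: h; apply/negP; apply: pochhammer_neq0 => // s s0.
  apply/negP => /eqP hs; apply: (hk (- s%:Z)).
  apply: (mulfI (expf_neq0 s (e2pii_neq0 tau))).
  by rewrite hs -exprnN divff// expf_neq0// e2pii_neq0.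
- apply: contrapT => /forallNP hk; move/eqP: h; apply/negP; apply: pochhammer_neq0 => // s s0.
  apply/negP => /eqP hs; apply: (hk s%:Z).
  apply: (mulIf (e2pii_neq0 (- x))).
  by rewrite -e2piiD subrr e2pii0 [_ ^ _]/(q ^+ s) hs.
Qed.

(** If x and x + s were both zeros, e(x) = q^k and e(x + s) = q^l would have the
    same modulus, whence k = l and e(s) = 1. *)
Lemma theta_zero_isolated x (s : R) : 0 < s < 2^-1 -> th x = 0 -> th (x + s%:C) != 0.
Proof.
move=> hs /theta_eq0[k hk]; apply/eqP => /theta_eq0[l hl].
have := e2pii_real_inj x hs; rewrite hl hk; apply/negP; rewrite negbK.
suff : l = k by move=> ->.
have : normc (q ^ l) = normc (q ^ k).
  by rewrite -hl -hk !normc_e2pii; case: x {hk hl} => a b; rewrite /= addr0.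
have normcXz m : normc (q ^ m) = normc q ^ m.
  case: m => n; first exact: normcX.
  by rewrite NegzE -!exprnN normcV normcX.
rewrite !normcXz; apply: ieexprIz; first by case/andP: normc_nome.
by rewrite lt_eqF.
Qed.

Lemma differentiable_theta x : differentiable (th : R[i]^o -> R[i]^o) (x : R[i]^o).
Proof.
pose F (c : R[i]) (y : R[i]^o) : R[i]^o := e2pii (c * y).
have dF c (y : R[i]^o) : differentiable (F c) y.
  apply: (@differentiable_comp _ _ _ _ (fun y : R[i]^o => c * y : R[i]^o)).
    by apply: (@differentiableM _ R[i]^o); [exact: differentiable_cst|exact: ex_diff].
  exact: differentiable_e2pii.
pose G (c : R[i]) (y : R[i]^o) : R[i]^o := pochhammer q (F c y).
have dG c (y : R[i]^o) : differentiable (G c) y.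
  apply: (@differentiable_comp _ _ _ _ (F c)); first exact: dF.
  exact: differentiable_pochhammer.
have -> : (th : R[i]^o -> R[i]^o) = (fun y => theta_const * (F 2^-1 y - F (- 2^-1) y)
    * (G 1 y * G (-1) y)).
  by apply/funext => y; rewrite thetaE /G /F mulN1r mul1r mulNr ![_^-1 * _]mulrC.
apply: (@differentiableM _ R[i]^o); last exact: (@differentiableM _ R[i]^o).
apply: (@differentiableM _ R[i]^o); first exact: differentiable_cst.
exact: (@differentiableB _ R[i]^o).
Qed.
End Theta.

(** * Quotients of theta functions at affine forms *)

Section ThetaQuotient.
Context {R : realType} {n : nat} {D : root_datum n} (B : root_base D).
Context (tau : R[i]) (tau_im : 0 < complex.Im tau) (i : 'I_(ss_rank B)).
Local Notation V := (univ_cover R n).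
Local Notation alpha := (simple B i).
Local Notation th := (theta tau).
Implicit Types (p : V) (c : R[i]) (x y k : int) (m : 'rV[int]_n).

Definition affine c x y p : R[i] := c + x%:~R * zc i p + y%:~R * lc i p.

Let kz m := pairing D alpha m.
Let kl m := pairing D m (coroot D alpha).

Lemma zc_shift (a : R[i]) m p : zc i (p.1 + a *: cplx m, p.2) = zc i p + a * (kz m)%:~R.
Proof. by rewrite /zc /= pairingDr pairingZr pairing_cplx. Qed.

Lemma lc_shift (a : R[i]) m p : lc i (p.1, p.2 + a *: cplx m) = lc i p + a * (kl m)%:~R.
Proof. by rewrite /lc /= pairingDl pairingZl pairing_cplx. Qed.

Lemma affine_shift_z (a : R[i]) c x y m p :
  affine c x y (p.1 + a *: cplx m, p.2) = affine c x y p + (x * kz m)%:~R * a.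
Proof. by rewrite /affine zc_shift intrM -/(lc i p); ring. Qed.

Lemma affine_shift_l (a : R[i]) c x y m p :
  affine c x y (p.1, p.2 + a *: cplx m) = affine c x y p + (y * kl m)%:~R * a.
Proof. by rewrite /affine lc_shift intrM -/(zc i p); ring. Qed.

(** Along this vector both z_alpha and lambda_alpha^vee grow with slope 2, so that
    an affine form with x + y nonzero is nonconstant along it; a single line thus
    avoids the zeros of both denominators. *)
Definition cross_direction : V := (cplx (coroot D alpha), cplx alpha).

Lemma affine_cross c x y p (t : R[i]) :
  affine c x y (p + t *: cross_direction) = affine c x y p + (x + y)%:~R * (2 * t).
Proof.
have zE : zc i (p + t *: cross_direction) = zc i p + t * 2.
  apply: (etrans (zc_shift t (coroot D alpha) p)); congr (_ + t * _).
  exact: (congr1 intr (pairing_coroot (simple_root i))).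
have lE : lc i (p + t *: cross_direction) = lc i p + t * 2.
  apply: (etrans (lc_shift t alpha p)); congr (_ + t * _).
  exact: (congr1 intr (pairing_coroot (simple_root i))).
by rewrite /affine zE lE intrD; move: (zc i p) (lc i p) => z l; ring.
Qed.

Lemma differentiable_affine c x y p :
  differentiable (affine c x y : V -> R[i]^o) p.
Proof.
have dcoord (pi : V -> 'rV[R[i]]_n) (u : 'rV[R[i]]_n) : differentiable pi p ->
    differentiable ((fun p : V => \sum_j u 0 j * pi p 0 j) : V -> R[i]^o) p.
  move=> dpi.
  have -> : ((fun p : V => \sum_j u 0 j * pi p 0 j) : V -> R[i]^o) =
      \sum_j (fun p : V => u 0 j * pi p 0 j : R[i]^o).
    by apply/funext => v; rewrite fct_sumE.
  apply: (@differentiable_sum R[i] V R[i]^o) => j.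
  apply: (@differentiableM R[i] V); first exact: differentiable_cst.
  apply: (@differentiable_comp R[i] V _ R[i]^o pi (fun v => v 0 j)).
    exact: dpi.
  exact: differentiable_coord.
have zcE : (zc i : V -> R[i]) =
    (fun p => \sum_j (cplx alpha *m map_mx intr (pairing_mx D)) 0 j * p.1 0 j).
  by apply/funext => v; rewrite /zc /pairing_of mxE; apply: eq_bigr => j _; rewrite [_^T _ _]mxE.
have lcE : (lc i : V -> R[i]) =
    (fun p => \sum_j (cplx (coroot D alpha) *m (map_mx intr (pairing_mx D))^T) 0 j * p.2 0 j).
  apply/funext => v; rewrite /lc /pairing_of -mulmxA mxE; apply: eq_bigr => j _.
  by rewrite mulrC -[in LHS](trmxK (map_mx intr (pairing_mx D))) -trmx_mul [_^T _ _]mxE.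
have dz : differentiable (zc i : V -> R[i]^o) p.
  by rewrite zcE; apply: (dcoord fst); apply: linear_differentiable => v; exact: cvg_fst.
have dl : differentiable (lc i : V -> R[i]^o) p.
  by rewrite lcE; apply: (dcoord snd); apply: linear_differentiable => v; exact: cvg_snd.
apply: (@differentiableD R[i] V R[i]^o); last first.
  by apply: (@differentiableM R[i] V); [exact: differentiable_cst|exact: dl].
apply: (@differentiableD R[i] V R[i]^o); first exact: differentiable_cst.
by apply: (@differentiableM R[i] V); [exact: differentiable_cst|exact: dz].
Qed.

(** The two arguments of theta differ by a real number of modulus below 1/2. *)
Lemma theta_affine_isolated c x y p (s t : R) :
  x + y = 1 \/ x + y = -1 -> 0 < s < 4^-1 -> 0 < t < 4^-1 -> s != t ->
  th (affine c x y (p + s%:C *: cross_direction)) = 0 ->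
  th (affine c x y (p + t%:C *: cross_direction)) != 0.
Proof.
move=> xy /andP[s0 s1] /andP[t0 t1] st.
have iso (a b : R[i]) (r : R) : b = a + r%:C -> - 2^-1 < r < 2^-1 -> r != 0 ->
    th a = 0 -> th b != 0.
  move=> -> /andP[r1 r2] r0 a0; have [rpos|rneg] := ltP 0 r.
    by apply: theta_zero_isolated; rewrite ?rpos.
  apply/eqP => b0; have := @theta_zero_isolated _ tau tau_im _ (- r) _ b0.
  rewrite -[(- r)%:C]/((real_complex R) (- r)) rmorphN addrK a0 eqxx => H.
  by suff /H : 0 < - r < 2^-1 by []; rewrite oppr_gt0 lt_neqAle r0 rneg ltrNl r1.
set e : R := (x + y)%:~R.
have eE : (x + y)%:~R = e%:C :> R[i] by rewrite -[RHS]/((real_complex R) e) rmorph_int.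
have e1 : e = 1 \/ e = -1 by rewrite /e; case: xy => ->; [left|right].
apply: (iso _ _ (e * (2 * (t - s)))).
- have Es := affine_cross c x y p s%:C; have Et := affine_cross c x y p t%:C.
  apply: (etrans Et); apply: (etrans _ (congr1 (fun z => z + _) (esym Es))).
  rewrite eE; move: (affine c x y p) => L.
  by rewrite -!/((real_complex R) _) !(rmorphM, rmorphB, rmorph_nat) /=; ring.
- by case: e1 => ->; apply/andP; split; lra.
- rewrite !mulf_neq0 ?subr_eq0//; last by rewrite eq_sym.
  by case: e1 => ->; rewrite ?oppr_eq0 oner_neq0.
Qed.

Lemma open_cross (O : set V) p : open O -> O p ->
  exists2 d : R, 0 < d & forall t : R, 0 < t < d -> O (p + t%:C *: cross_direction).
Proof.
move=> oO Op.
have cont : (fun t : R[i]^o => p + t *: cross_direction) @ (0 : R[i]^o) --> p.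
  rewrite -[X in _ --> X]addr0 -[X in _ --> p + X](scale0r cross_direction).
  exact: (@cvgD R[i] V R[i]^o _ _ (fun=> p) _ p _ (@cvg_cst V p R[i]^o _ _)
    (@scalel_continuous R[i] V cross_direction 0)).
have /cont [e e0 he] := open_nbhs_nbhs (conj oO Op).
have [e0' eE] := gt0_Re e0.
exists (complex.Re e) => // t /andP[t0 te]; apply: he.
rewrite /ball_ /= sub0r normrN eE norm_normc ltcR /=.
by rewrite expr0n addr0 sqrtr_sqr gtr0_norm.
Qed.

Section Quotient.
Context (c1 c2 c3 c4 : R[i]) (x1 x2 x3 x4 y1 y2 y3 y4 : int).
Let l1 := affine c1 x1 y1.
Let l2 := affine c2 x2 y2.
Let l3 := affine c3 x3 y3.
Let l4 := affine c4 x4 y4.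

Definition theta_quotient p := (th (l1 p) * th (l2 p)) / (th (l3 p) * th (l4 p)).

Lemma meromorphic_theta_quotient :
  x3 + y3 = 1 \/ x3 + y3 = -1 -> x4 + y4 = 1 \/ x4 + y4 = -1 ->
  meromorphic theta_quotient.
Proof.
move=> h3 h4.
have dth c x y p : differentiable (th \o affine c x y : V -> R[i]^o) p.
  apply: (@differentiable_comp R[i] V R[i]^o R[i]^o (affine c x y) th).
    exact: differentiable_affine.
  exact: (differentiable_theta tau_im).
move=> p; exists setT, (fun p => th (l1 p) * th (l2 p)), (fun p => th (l3 p) * th (l4 p)).
split; [by split; [exact: openT|]| | | |by []].
- by move=> u _; apply: (@differentiableM _ V); exact: dth.
- by move=> u _; apply: (@differentiableM _ V); exact: dth.
move=> O oO _ [u Ou].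
have [d d0 hd] := open_cross oO Ou.
set e : R := Num.min d 4^-1.
have e0 : 0 < e by rewrite lt_min d0 invr_gt0 ltr0n.
have eP (k : nat) : (1 < k)%N -> 0 < e / k%:R < e.
  move=> k1; rewrite divr_gt0 ?ltr0n ?(ltn_trans _ k1)//=.
  by rewrite ltr_pdivrMr ?ltr0n ?(ltn_trans _ k1)// ltr_pMr// ltr1n.
have eQ (k : nat) : (1 < k)%N -> 0 < e / k%:R < 4^-1.
  move=> k1; have /andP[-> /lt_le_trans] := eP k k1; apply.
  by rewrite ge_min lexx orbT.
have eO (k : nat) : (1 < k)%N -> O (u + (e / k%:R)%:C *: cross_direction).
  move=> k1; apply: hd; have /andP[-> /lt_le_trans] := eP k k1; apply.
  by rewrite ge_min lexx.
have eN (j k : nat) : (1 < k)%N -> (k < j)%N -> e / j%:R != e / k%:R.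
  move=> k1 kj; rewrite (inj_eq (mulfI (lt0r_neq0 e0))) (inj_eq invr_inj) eqr_nat.
  by rewrite gtn_eqF.
(* Each factor vanishes for at most one of the parameters e/2, e/3, e/4, so one of
   the three parameters is good for both. *)
have iso3 (j k : nat) (k1 : (1 < k)%N) (kj : (k < j)%N) :=
  @theta_affine_isolated c3 x3 y3 u _ _ h3 (eQ j (ltn_trans k1 kj)) (eQ k k1) (eN _ _ k1 kj).
have iso4 (j k : nat) (k1 : (1 < k)%N) (kj : (k < j)%N) :=
  @theta_affine_isolated c4 x4 y4 u _ _ h4 (eQ j (ltn_trans k1 kj)) (eQ k k1) (eN _ _ k1 kj).
apply: contrapT => hO.
have hk (k : nat) : (1 < k)%N -> (th (l3 (u + (e / k%:R)%:C *: cross_direction)) == 0) ||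
     (th (l4 (u + (e / k%:R)%:C *: cross_direction)) == 0).
  move=> k1; rewrite -mulf_eq0; apply: contrapT => /negP h; apply: hO.
  by exists (u + (e / k%:R)%:C *: cross_direction); [exact: eO|].
have := hk 2 isT; have := hk 3 isT; have := hk 4 isT.
case/orP=> /eqP a4 /orP[|] /eqP a3 /orP[|] a2.
- by move: (iso3 4 3 isT isT a4); rewrite a3 eqxx.
- by move: (iso3 4 3 isT isT a4); rewrite a3 eqxx.
- by move: (iso3 4 2 isT isT a4); rewrite a2.
- by move: (iso4 3 2 isT isT a3); rewrite a2.
- by move: (iso3 3 2 isT isT a3); rewrite a2.
- by move: (iso4 4 2 isT isT a4); rewrite a2.
- by move: (iso4 4 3 isT isT a4); rewrite a3 eqxx.
- by move: (iso4 4 3 isT isT a4); rewrite a3 eqxx.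
Qed.

Lemma quotient_mult (a1 a2 a3 a4 b1 b2 b3 b4 : R[i]) :
  (e2pii a1 * b1 * (e2pii a2 * b2)) / (e2pii a3 * b3 * (e2pii a4 * b4)) =
  e2pii (a1 + a2 - a3 - a4) * ((b1 * b2) / (b3 * b4)).
Proof.
by rewrite !e2piiD !e2piiN !invfM; ring.
Qed.

(** The conditions on squares cancel the quadratic exponents of the four factors;
    the linear exponents that remain are the multiplier.  The conditions on
    x_j + y_j make the denominator nonzero on a dense set. *)
Lemma theta_quotient_section (M : line_bundle R n) :
  x3 + y3 = 1 \/ x3 + y3 = -1 -> x4 + y4 = 1 \/ x4 + y4 = -1 ->
  x1 ^+ 2 + x2 ^+ 2 = x3 ^+ 2 + x4 ^+ 2 ->
  y1 ^+ 2 + y2 ^+ 2 = y3 ^+ 2 + y4 ^+ 2 ->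
  (forall m p, mult_z M m p = e2pii (- (kz m)%:~R *
     (x1%:~R * l1 p + x2%:~R * l2 p - x3%:~R * l3 p - x4%:~R * l4 p))) ->
  (forall m p, mult_l M m p = e2pii (- (kl m)%:~R *
     (y1%:~R * l1 p + y2%:~R * l2 p - y3%:~R * l3 p - y4%:~R * l4 p))) ->
  rational_section tau M theta_quotient.
Proof.
move=> h3 h4 hx hy hz hl.
have shift_int (z1 z2 z3 z4 k : int) (b1 b2 b3 b4 : R[i]) :
    z1 ^+ 2 + z2 ^+ 2 = z3 ^+ 2 + z4 ^+ 2 ->
    th (b1 + (z1 * k)%:~R * 1) * th (b2 + (z2 * k)%:~R * 1) /
    (th (b3 + (z3 * k)%:~R * 1) * th (b4 + (z4 * k)%:~R * 1)) =
    th b1 * th b2 / (th b3 * th b4).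
  move=> /(congr1 (fun z => z%:~R : R[i])) hzz; rewrite /= !intrD !expr2 !intrM in hzz.
  rewrite !mulr1 !theta_shift_int// quotient_mult.
  rewrite (_ : _ + _ - _ - _ = 0) ?e2pii0 ?mul1r// !intrM.
  rewrite (_ : _ + _ - _ - _ = (k%:~R ^+ 2 / 2) *
    (z1%:~R * z1%:~R + z2%:~R * z2%:~R - (z3%:~R * z3%:~R + z4%:~R * z4%:~R))); last by field.
  by rewrite hzz subrr mulr0.
have shift_tau (z1 z2 z3 z4 k : int) (b1 b2 b3 b4 : R[i]) :
    z1 ^+ 2 + z2 ^+ 2 = z3 ^+ 2 + z4 ^+ 2 ->
    th (b1 + (z1 * k)%:~R * tau) * th (b2 + (z2 * k)%:~R * tau) /
    (th (b3 + (z3 * k)%:~R * tau) * th (b4 + (z4 * k)%:~R * tau)) =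
    e2pii (- k%:~R * (z1%:~R * b1 + z2%:~R * b2 - z3%:~R * b3 - z4%:~R * b4)) *
    (th b1 * th b2 / (th b3 * th b4)).
  move=> /(congr1 (fun z => z%:~R : R[i])) hzz; rewrite /= !intrD !expr2 !intrM in hzz.
  rewrite !theta_shift_tau// quotient_mult; congr (e2pii _ * _); rewrite !intrM.
  rewrite [RHS](_ : _ = k%:~R ^+ 2 * ((1 - tau) / 2) *
    (z1%:~R * z1%:~R + z2%:~R * z2%:~R - (z3%:~R * z3%:~R + z4%:~R * z4%:~R))
    + - k%:~R * (z1%:~R * b1 + z2%:~R * b2 - z3%:~R * b3 - z4%:~R * b4)).
    by field.
  by rewrite hzz subrr mulr0 add0r.
have everywhere (f g : V -> R[i]) : f =1 g -> mero_eq f g.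
  by move=> fg; exists setT; split; [exact: openT|by move=> O; rewrite setIT|move=> x _; exact: fg].
split.
- exact: meromorphic_theta_quotient.
- move=> m; apply: everywhere => p.
  by rewrite /theta_quotient /l1 /l2 /l3 /l4 -(scale1r (cplx m)) !affine_shift_z shift_int.
- move=> m; apply: everywhere => p.
  by rewrite /theta_quotient /l1 /l2 /l3 /l4 -(scale1r (cplx m)) !affine_shift_l shift_int.
- move=> m; apply: everywhere => p.
  by rewrite /theta_quotient hz /l1 /l2 /l3 /l4 !affine_shift_z shift_tau.
- move=> m; apply: everywhere => p.
  by rewrite /theta_quotient hl /l1 /l2 /l3 /l4 !affine_shift_l shift_tau.
Qed.
End Quotient.
End ThetaQuotient.

(** * Multipliers of the twisted bundles *)

Section Multipliers.
Context {R : realType} {n : nat} {D : root_datum n} (B : root_base D).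
Context (hbar : R[i]) (i : 'I_(ss_rank B)).
Local Notation alpha := (simple B i).
Local Notation s := (s_simple i).
Implicit Types (m : 'rV[int]_n) (p : univ_cover R n).

Lemma cplx_mul m (A : 'M[int]_n) : cplx (m *m A) = cplx m *m map_mx intr A :> 'rV[R[i]]_n.
Proof. by rewrite /cplx map_mxM. Qed.

Lemma pairing_mul_refl (x y : 'rV[R[i]]_n) :
  pairing D (x *m map_mx intr (refl_mx D alpha)) y =
  pairing D x y - pairing D x (cplx (coroot D alpha)) *
    pairing D (cplx alpha) y.
Proof. by rewrite mul_refl_mx pairingBl pairingZl. Qed.

Lemma pairing_mul_corefl (x y : 'rV[R[i]]_n) :
  pairing D x (y *m map_mx intr (corefl_mx D alpha)) =
  pairing D x y - pairing D x (cplx (coroot D alpha)) *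
    pairing D (cplx alpha) y.
Proof. by rewrite mul_corefl_mx pairingBr pairingZr mulrC. Qed.

Lemma pairing_rho_shift (x y : 'rV[R[i]]_n) :
  pairing D (x + hbar *: rho B) y =
  pairing D x y + hbar * pairing D (rho B) y.
Proof. by rewrite pairingDl pairingZl. Qed.

Lemma pairing_rho_vee_shift (x y : 'rV[R[i]]_n) :
  pairing D x (y - hbar *: rho_vee B) =
  pairing D x y - hbar * pairing D x (rho_vee B).
Proof. by rewrite pairingBr pairingZr. Qed.

Lemma lcE (z l : 'rV[R[i]]_n) :
  lc i (z, l) = pairing D l (cplx (coroot D alpha)).
Proof. by []. Qed.

Lemma zcE (z l : 'rV[R[i]]_n) :
  zc i (z, l) = pairing D (cplx alpha) z.
Proof. by []. Qed.

(** Reduces the equality of two multipliers to an identity between the exponents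
    and proves it.  The pairings are generalized before [ring], which would
    otherwise compare them up to conversion. *)
Ltac expand_multipliers :=
  rewrite /= !cplx_mul ?invmx1 ?(invmx_refl_mx (simple_root i))
    ?(invmx_corefl_mx (simple_root i)) ?map_mx1 ?mulmx1 -?e2piiN -?e2piiD;
  congr e2pii;
  rewrite ?pairing_rho_shift ?pairing_rho_vee_shift;
  rewrite ?(pairing_mul_refl, pairing_mul_corefl);
  rewrite ?pairing_rho ?pairing_rho_vee ?pairing_cplx ?(pairing_coroot (simple_root i));
  rewrite ?lcE ?zcE;
  repeat (match goal with |- context [@pairing_of ?K ?d ?P ?x ?y] =>
    generalize (@pairing_of K d P x y); intro end);
  ring.

Lemma mult_z_S''_id m p : mult_z (bundle_S'' B hbar (weyl_id D) s) m p =
  e2pii (- (pairing D alpha m)%:~R * lc i p).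
Proof. by case: p => z l; expand_multipliers. Qed.

Lemma mult_l_S''_id m p : mult_l (bundle_S'' B hbar (weyl_id D) s) m p =
  e2pii (- (pairing D m (coroot D alpha))%:~R * (zc i p - hbar)).
Proof. by case: p => z l; expand_multipliers. Qed.

Lemma mult_z_S''_s m p : mult_z (bundle_S'' B hbar s s) m p =
  e2pii (- (pairing D alpha m)%:~R * - hbar).
Proof. by case: p => z l; expand_multipliers. Qed.

Lemma mult_l_S''_s m p : mult_l (bundle_S'' B hbar s s) m p =
  e2pii (- (pairing D m (coroot D alpha))%:~R * - hbar).
Proof. by case: p => z l; expand_multipliers. Qed.

Lemma mult_z_S'_id m p : mult_z (bundle_S' B hbar s (weyl_id D)) m p =
  e2pii (- (pairing D alpha m)%:~R * (lc i p + hbar)).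
Proof. by case: p => z l; expand_multipliers. Qed.

Lemma mult_l_S'_id m p : mult_l (bundle_S' B hbar s (weyl_id D)) m p =
  e2pii (- (pairing D m (coroot D alpha))%:~R * zc i p).
Proof. by case: p => z l; expand_multipliers. Qed.

Lemma mult_z_S'_s m p : mult_z (bundle_S' B hbar s s) m p =
  e2pii (- (pairing D alpha m)%:~R * hbar).
Proof. by case: p => z l; expand_multipliers. Qed.

Lemma mult_l_S'_s m p : mult_l (bundle_S' B hbar s s) m p =
  e2pii (- (pairing D m (coroot D alpha))%:~R * hbar).
Proof. by case: p => z l; expand_multipliers. Qed.
End Multipliers.

(** * The four coefficients and their sums *)

Section Sections.
Context {R : realType} {n : nat} {D : root_datum n} (B : root_base D).
Context (tau hbar : R[i]) (tau_im : 0 < complex.Im tau) (i : 'I_(ss_rank B)).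
Local Notation s := (s_simple i).
Local Notation th := (theta tau).

(** The arguments of [theta_quotient] below are the constants c_1, ..., c_4, then
    the coefficients of z_alpha, then those of lambda_alpha^vee. *)
Lemma section_DL_id : rational_section tau (bundle_S'' B hbar (weyl_id D) s) (fun p =>
  (th hbar * th (zc i p + lc i p)) / (th (zc i p) * th (hbar + lc i p))).
Proof.
have -> : (fun p => (th hbar * th (zc i p + lc i p)) / (th (zc i p) * th (hbar + lc i p))) =
    theta_quotient tau i hbar 0 0 hbar 0 1 1 0 0 1 0 1.
  apply/funext => p; rewrite /theta_quotient /affine.
  by move: (zc i p) (lc i p) => z l; rewrite !(mul0r, mul1r, addr0, add0r).
apply: theta_quotient_section => //; try by [left].
- by move=> m p; rewrite mult_z_S''_id /affine; congr e2pii;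
  move: (zc i p) (lc i p) => z l; ring.
- by move=> m p; rewrite mult_l_S''_id /affine; congr e2pii;
  move: (zc i p) (lc i p) => z l; ring.
Qed.

Lemma section_DL_s : rational_section tau (bundle_S'' B hbar s s) (fun p =>
  (th (hbar - zc i p) * th (- lc i p)) / (th (zc i p) * th (hbar + lc i p))).
Proof.
have -> : (fun p => (th (hbar - zc i p) * th (- lc i p)) / (th (zc i p) * th (hbar + lc i p))) =
    theta_quotient tau i hbar 0 0 hbar (-1) 0 1 0 0 (-1) 0 1.
  apply/funext => p; rewrite /theta_quotient /affine.
  by move: (zc i p) (lc i p) => z l; rewrite !(mulN1r, mul0r, mul1r, addr0, add0r).
apply: theta_quotient_section => //; try by [left].
- by move=> m p; rewrite mult_z_S''_s /affine; congr e2pii;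
  move: (zc i p) (lc i p) => z l; ring.
- by move=> m p; rewrite mult_l_S''_s /affine; congr e2pii;
  move: (zc i p) (lc i p) => z l; ring.
Qed.

Lemma section_DL_dual_id : rational_section tau (bundle_S' B hbar s (weyl_id D)) (fun p =>
  (th hbar * th (lc i p + zc i p)) / (th (lc i p) * th (hbar - zc i p))).
Proof.
have -> : (fun p => (th hbar * th (lc i p + zc i p)) / (th (lc i p) * th (hbar - zc i p))) =
    theta_quotient tau i hbar 0 0 hbar 0 1 0 (-1) 0 1 1 0.
  apply/funext => p; rewrite /theta_quotient /affine.
  by move: (zc i p) (lc i p) => z l; rewrite [l + z]addrC !(mulN1r, mul0r, mul1r, addr0, add0r).
apply: theta_quotient_section => //; try by [left|right].
- by move=> m p; rewrite mult_z_S'_id /affine; congr e2pii;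
  move: (zc i p) (lc i p) => z l; ring.
- by move=> m p; rewrite mult_l_S'_id /affine; congr e2pii;
  move: (zc i p) (lc i p) => z l; ring.
Qed.

Lemma section_DL_dual_s : rational_section tau (bundle_S' B hbar s s) (fun p =>
  (th (hbar + lc i p) * th (- zc i p)) / (th (lc i p) * th (hbar - zc i p))).
Proof.
have -> : (fun p => (th (hbar + lc i p) * th (- zc i p)) / (th (lc i p) * th (hbar - zc i p))) =
    theta_quotient tau i hbar 0 0 hbar 0 (-1) 0 (-1) 1 0 1 0.
  apply/funext => p; rewrite /theta_quotient /affine.
  by move: (zc i p) (lc i p) => z l; rewrite !(mulN1r, mul0r, mul1r, addr0, add0r).
apply: theta_quotient_section => //; try by [left|right].
- by move=> m p; rewrite mult_z_S'_s /affine; congr e2pii;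
  move: (zc i p) (lc i p) => z l; ring.
- by move=> m p; rewrite mult_l_S'_s /affine; congr e2pii;
  move: (zc i p) (lc i p) => z l; ring.
Qed.

Lemma mero_eq_refl (f : univ_cover R n -> R[i]) : mero_eq f f.
Proof. by exists setT; split; [exact: openT|by move=> O; rewrite setIT|]. Qed.

Lemma rational_section0 (M : line_bundle R n) : rational_section tau M (fun=> 0).
Proof.
split.
- move=> p; exists setT, (fun=> 0), (fun=> 1); split.
  + by split; [exact: openT|].
  + by move=> x _; exact: differentiable_cst.
  + by move=> x _; exact: differentiable_cst.
  + by move=> O _ _ [x Ox]; exists x => //; exact: oner_neq0.
  + by move=> x _ _; rewrite mul0r.
- by move=> m; exact: mero_eq_refl.
- by move=> m; exact: mero_eq_refl.
- by move=> m; under [X in mero_eq _ X]eq_fun do rewrite mulr0; exact: mero_eq_refl.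
- by move=> m; under [X in mero_eq _ X]eq_fun do rewrite mulr0; exact: mero_eq_refl.
Qed.

(** s_alpha moves alpha to - alpha; without this the two components would overlap. *)
Lemma weyl_id_neq_s : weyl_id D != s.
Proof.
apply/eqP => /(congr1 val) /= [e _].
have aP := simple_root i; set a := simple B i in aP e.
have := refl_mxE D a; rewrite -e => /eqP; rewrite -subr_eq0 opprB addrC subrK => /eqP.
move=> /(congr1 (mulmx a)); rewrite mulmx0 !mulmxA.
have := pairing_coroot aP; rewrite /pairing_of map_intr_mx => h.
rewrite [X in X *m _ = _]mx11_scalar h mul_scalar_mx.
by move/(root_scale_eq0 aP).
Qed.

Lemma add_if_disjoint (W : eqType) (T : Type) (V : nmodType) (f g : T -> V) (p : T)
    (w v w' v' u x : W) : (w = w' -> v <> v') ->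
  (if (u == w) && (x == v) then f p else 0)
    + (if (u == w') && (x == v') then g p else 0) =
  (if (u == w) && (x == v) then f
   else if (u == w') && (x == v') then g else fun=> 0) p.
Proof.
move=> ne; case: ifP => [/andP[/eqP -> /eqP ->]|_]; last by rewrite add0r; case: ifP.
by case: ifP => [/andP[/eqP e1 /eqP e2]|_]; [case: (ne e1 e2)|rewrite addr0].
Qed.

Lemma two_term_section (S : weyl D -> weyl D -> line_bundle R n)
    (w v w' v' : weyl D) (f g : univ_cover R n -> R[i]) :
  (w = w' -> v <> v') ->
  rational_section tau (S w v) f -> rational_section tau (S w' v') g ->
  rational_section_sum tau S (graded_add (homog w v f) (homog w' v' g)).
Proof.
move=> ne hf hg.
have E u x : graded_add (homog w v f) (homog w' v' g) u x =
    if (u == w) && (x == v) then f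
    else if (u == w') && (x == v') then g else fun=> 0.
  by apply/funext => p; exact: add_if_disjoint.
split.
  move=> u x; rewrite E; case: ifP => [/andP[/eqP -> /eqP ->] //|_].
  by case: ifP => [/andP[/eqP -> /eqP ->] //|_]; exact: rational_section0.
apply: (@sub_finite_set _ _ [set (w, v); (w', v')]); last exact: finite_set2.
move=> [u x] /=; rewrite E; case: ifP => [/andP[/eqP -> /eqP ->]|_]; first by left.
case: ifP => [/andP[/eqP -> /eqP ->]|_]; first by right.
by case; exact: mero_eq_refl.
Qed.
End Sections.

Theorem theorem3p8 (R : realType) (n : nat) (D : root_datum n)
    (B : root_base D) (tau hbar : R[i]) (tau_im : 0 < complex.Im tau)
    (i : 'I_(ss_rank B)) :
  rational_section_sum tau (bundle_S'' B hbar) (DL tau hbar i) /\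
  rational_section_sum tau (bundle_S' B hbar) (DL_dual tau hbar i).
Proof.
split; apply: two_term_section.
- by move=> /eqP; rewrite (negbTE (weyl_id_neq_s i)).
- exact: section_DL_id.
- exact: section_DL_s.
- by move=> _ /eqP; rewrite (negbTE (weyl_id_neq_s i)).
- exact: section_DL_dual_id.
- exact: section_DL_dual_s.
Qed.
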